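(* Let $(\sigma^n_t)_{t\in[0,\infty)}$ be the birth Mallows process on $\mathcal{S}_n$, and for $i\in[n]$ and $t\in\mathbb{R}$ let $X_i^n(t)=\frac1n\sigma^n_{e^{t/n}}(i)$. Then for any $T>0$, $\alpha>0$ and $\varepsilon>0$, $$\mathbb{P}\left(\max_{i\in(\alpha n,(1-\alpha)n)}\ \sup_{t\in[-T,T]}\left|X_i^n(t)-z_{\frac in,X_i^n(0)}(t)\right|>\varepsilon\right)\longrightarrow 0\quad\text{as } n\to\infty,$$ where, for $x,a\in[0,1]$ and $t\in\mathbb{R}$, $$z_{x,a}(t)=\frac1t\log\left(\frac{e^{xt}(1-a)+ae^t}{e^{xt}(1-a)+a}\right)\ (t\ne0),\qquad z_{x,a}(0)=a.$$
   Context: $\mathcal{S}_n$ is the group of permutations of $[n]=\{1,\dots,n\}$. For $\sigma\in\mathcal{S}_n$ and $i\in[n]$, the number of left inversions of $i$ is $\ell_i(\sigma)=|\{j\in\{1,\dots,i-1\}:\sigma(j)>\sigma(i)\}|$. The map $\sigma\mapsto(\ell_1(\sigma),\dots,\ell_n(\sigma))$ is a bijection from $\mathcal{S}_n$ onto $\{0\}\times\{0,1\}\times\dots\times\{0,1,\dots,n-1\}$. Birth Mallows process: for each $i\in[n]$ let $(\ell^n_i(t))_{t\in[0,\infty)}$ be a càdlàg time-inhomogeneous Markov birth process with values in $\{0,\dots,i-1\}$, started at $\ell_i^n(0)=0$, whose rate of jumping from $j$ to $j+1$ at time $t$ is $$p_i(j,t)=\frac1{1-t}\left(j+1-\frac{i\,t^{i-j-1}(t^{j+1}-1)}{t^i-1}\right)\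 (t\neq1),\qquad p_i(j,1)=\tfrac12(j+1)(i-j-1),$$ for $j=0,\dots,i-1$ (with $0^0=1$), the processes being independent over $i\in[n]$. The birth Mallows process $(\sigma^n_t)_{t\in[0,\infty)}$ is defined by letting $\sigma^n_t$ be the unique permutation in $\mathcal{S}_n$ with $(\ell_1(\sigma^n_t),\dots,\ell_n(\sigma^n_t))=(\ell^n_1(t),\dots,\ell^n_n(t))$. The maximum over an empty set of indices is taken to be $0$. *)

(* Defs.v *)
From HB Require Import structures.
From mathcomp Require Import all_boot all_order all_algebra all_fingroup.
From mathcomp Require Import all_classical all_reals all_analysis.

Set Implicit Arguments.
Unset Strict Implicit.
Unset Printing Implicit Defensive.

Import Order.TTheory GRing.Theory Num.Theory.
Import numFieldNormedType.Exports.

Local Open Scope classical_set_scope.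
Local Open Scope ring_scope.

(* Indices are zero-based: [i : 'I_n] stands for the element [i.+1] of
   {1, ..., n}, and a permutation [s : 'S_n] sends [i.+1] to [(s i).+1]. *)

Definition left_inversions (n : nat) (s : 'S_n) (i : 'I_n) : nat :=
  #|[pred j : 'I_n | (j < i)%N && (s i < s j)%N]|.

(* The subtraction of naturals is exact in the range j < i of interest, and
   [0 ^+ 0 = 1]. *)
Definition mallows_rate (R : realType) (i j : nat) (t : R) : R :=
  if t == 1 then 2^-1 * j.+1%:R * (i - j - 1)%:R
  else (1 - t)^-1 *
    (j.+1%:R - i%:R * t ^+ (i - j - 1) * (t ^+ j.+1 - 1) / (t ^+ i - 1)).

Definition cadlag (R : realType) (f : R -> R) : Prop :=
  (forall t : R, 0 <= t -> f s @[s --> t^'+] --> f t) /\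
  (forall t : R, 0 < t -> cvg (f s @[s --> t^'-])).

Definition cond_prob (R : realType) (d : measure_display)
    (Omega : measurableType d) (P : probability Omega R)
    (A B : set Omega) : R :=
  fine (P (A `&` B)) / fine (P B).

(* The sigma-algebra generated by the variables [Y u], for [u] in [D]. *)
Definition sigma_of (R : realType) (Omega : Type) (Y : R -> Omega -> nat)
    (D : set R) : set (set Omega) :=
  <<s [set [set w | Y u w = k] | u in D & k in [set: nat]] >>.

Definition markov_property (R : realType) (d : measure_display)
    (Omega : measurableType d) (P : probability Omega R)
    (Y : R -> Omega -> nat) : Prop :=
  forall (s t : R) (j k : nat) (A : set Omega),
    0 <= s -> s < t -> sigma_of Y `[0, s] A ->
    (0 < P (A `&` [set w | Y s w = j]))%E ->
    cond_prob P [set w | Y t w = k] (A `&` [set w | Y s w = j]) =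
    cond_prob P [set w | Y t w = k] [set w | Y s w = j].

(* At time [u], when [s <= u <= t] and [t - s -> 0],
     P(Y t = j + 1 | Y s = j) = q j u (t - s) + o(t - s),
     P(Y t = j     | Y s = j) = 1 - q j u (t - s) + o(t - s).
   With the forward increments [s = u] alone, jumps of positive probability at
   deterministic times would not be excluded. *)
Definition birth_rate (R : realType) (d : measure_display)
    (Omega : measurableType d) (P : probability Omega R)
    (q : nat -> R -> R) (Y : R -> Omega -> nat) : Prop :=
  forall (j : nat) (u : R), 0 <= u -> forall eps : R, 0 < eps ->
  exists2 delta : R, 0 < delta &
  forall s t : R, 0 <= s -> s <= u -> u <= t -> s < t -> t - s < delta ->
    (0 < P [set w | Y s w = j])%E ->
    `|cond_prob P [set w | Y t w = j.+1] [set w | Y s w = j]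
        - q j u * (t - s)| <= eps * (t - s) /\
    `|cond_prob P [set w | Y t w = j] [set w | Y s w = j]
        - (1 - q j u * (t - s))| <= eps * (t - s).

(* Time-inhomogeneous birth process with values in {0, ..., m - 1}, indexed by
   [0, +oo[; the values of [Y] at negative times are irrelevant. *)
Record birth_process (R : realType) (d : measure_display)
    (Omega : measurableType d) (P : probability Omega R)
    (m : nat) (q : nat -> R -> R) (Y : R -> Omega -> nat) : Prop := {
  birth_measurable : forall t : R, 0 <= t -> measurable_fun setT (Y t) ;
  birth_range : forall (t : R) (w : Omega), 0 <= t -> (Y t w < m)%N ;
  birth_start : forall w : Omega, Y 0 w = 0%N ;
  birth_cadlag : forall w : Omega, cadlag (fun t : R => (Y t w)%:R : R) ;
  birth_monotone : forall (w : Omega) (s t : R),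
    0 <= s -> s <= t -> (Y s w <= Y t w)%N ;
  birth_markov : markov_property P Y ;
  birth_has_rate : birth_rate P q Y }.

(* Taking some of the events equal to [setT] gives the product rule for every
   subfamily. *)
Definition independent_processes (R : realType) (d : measure_display)
    (Omega : measurableType d) (P : probability Omega R)
    (n : nat) (Y : 'I_n -> R -> Omega -> nat) : Prop :=
  forall A : 'I_n -> set Omega,
    (forall i, sigma_of (Y i) `[0, +oo[ (A i)) ->
    P (\bigcap_(i in [set: 'I_n]) A i) = (\prod_(i < n) P (A i))%E.

Record birth_mallows_process (R : realType) (d : measure_display)
    (Omega : measurableType d) (P : probability Omega R)
    (n : nat) (l : 'I_n -> R -> Omega -> nat) (sigma : R -> Omega -> 'S_n) :
    Prop := {
  mallows_birth : forall i : 'I_n,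
    birth_process P i.+1 (@mallows_rate R i.+1) (l i) ;
  mallows_independent : independent_processes P l ;
  mallows_left_inversions : forall (t : R) (w : Omega) (i : 'I_n),
    0 <= t -> left_inversions (sigma t w) i = l i t w }.

Definition rescaled_path (R : realType) (Omega : Type) (n : nat)
    (sigma : R -> Omega -> 'S_n) (i : 'I_n) (t : R) (w : Omega) : R :=
  n%:R^-1 * (sigma (expR (t / n%:R)) w i).+1%:R.

Definition limit_path (R : realType) (x a t : R) : R :=
  if t == 0 then a
  else t^-1 * ln ((expR (x * t) * (1 - a) + a * expR t)
                  / (expR (x * t) * (1 - a) + a)).

(* Main.v *)
(* Write [[m]_q = 1 + q + ... + q^(m-1)], [X_t(i)] for the rescaled path, and let
   [l_i] have values in [{0, ..., i-1}].

   The rate [p_i] is such that the truncated geometric distribution function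
   [F_t(i, j) = [j+1]_t / [i]_t] solves the forward equation, so
   [P(l_i(t) <= j) = F_t(i, j)].  For the same reason [F_t(i, l_i(t))] is almost
   a martingale in [t], with drift and quadratic variation [O(1/n)] on the time
   window [[e^(-T/n), e^(T/n)]]; an exponential supermartingale then bounds its
   deviation from its value [(l_i(1)+1)/i] at time [1] by [exp(- c n)].

   At a fixed time [q], the number [r_k] of indices [j <= k] with
   [sigma(j) > sigma(i)] satisfies [r_i = l_i], [r_k = r_(k-1) + 1] if
   [l_k <= r_(k-1)] and [r_k = r_(k-1)] otherwise, and [r_n = n - sigma(i)].
   As the [l_k] are independent, [[r_k+1]_p / [k+1]_p] with [p = 1/q] is an exact
   martingale with increments [O(1/n)], hence also concentrated, for all initial
   values [r_i] simultaneously.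

   Since [r_n] increases with [r_i] and decreases with the other [l_k], while
   every [l_k] increases with time, the path of [sigma_t(i)] between two grid
   times is sandwiched between two chains driven by the left inversions at these
   times.  So finitely many times suffice, and eliminating [l_i] from the
   concentrated quantities leaves the equation that defines [z]. *)

Require Import Defs.
From HB Require Import structures.
From mathcomp Require Import all_boot all_order all_algebra all_fingroup.
From mathcomp Require Import all_classical all_reals all_analysis.
From mathcomp Require Import ring lra zify.
Import Order.TTheory GRing.Theory Num.Theory.
Import numFieldNormedType.Exports.
Local Open Scope classical_set_scope.
Local Open Scope ring_scope.
Set Implicit Arguments.
Unset Strict Implicit.
Unset Printing Implicit Defensive.

(** * Straddle derivatives *)

(** The hypotheses provide no Kolmogorov equation or Dynkin formula, only local asymptotics of
    conditional probabilities over short intervals around each time. The two facts about a single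
    left inversion count, its marginal law and the supermartingale inequality, are therefore phrased
    as monotonicity of a real function of time and derived from one principle,
    [straddle_nonincreasing], which applies to functions not known to be continuous. The martingale
    in time lives on the scale [q], the one along the chain on [1/q]. A Moebius map relates the
    scales, and [exp(- t (1 - z))] is affine in the same Moebius map, so the comparison with [z]
    involves no differential equation. The chain starts from the random [l_i]; bounding deviations
    for every deterministic start avoids conditioning on it, at the price of a union bound over
    order [n^2] pairs, which the exponential estimates absorb because the number of grid times stays
    fixed as [n] grows. *)

Section Straddle.
Variable R : realType.
Implicit Types (f : R -> R) (a b u s t eps : R).

(* Differences over intervals straddling [u], rather than increments from [u],
   because this is the form in which [birth_rate] provides the jump rates. *)
Definition straddle_derive f u df := forall eps, 0 < eps ->
  exists2 delta, 0 < delta & forall s t, s <= u -> u <= t -> t - s < delta ->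
    `|f t - f s - df * (t - s)| <= eps * (t - s).

(** The increments over [[s, u]] and [[u, t]] have errors at most [eps * (u - s)] and
    [eps * (t - u)], which add up to [eps * (t - s)]. *)
Lemma is_derive_straddle f u df :
  is_derive u 1 f df -> straddle_derive f u df.
Proof.
move=> [fu <-] eps e0.
have := fu; rewrite /derivable => /cvg_ex[l fl].
have dl : 'D_1 f u = l by exact: cvg_lim fl.
rewrite dl.
move/cvgrPdist_le : fl => /(_ _ e0).
rewrite near_withinE => -[d /= d0 H].
have key h : `|h| < d -> `|f (u + h) - f u - l * h| <= eps * `|h|.
  move=> hd; have [->|h0] := eqVneq h 0.
    by rewrite addr0 subrr mulr0 subr0 !normr0 mulr0.
  have := H h _ h0; rewrite /ball_ /= sub0r normrN => /(_ hd).
  rewrite scaler1 [_ *: _]mulrC [h + u]addrC => K.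
  have -> : f (u + h) - f u - l * h = - (l - (f (u + h) - f u) * h^-1) * h.
    by field.
  by rewrite normrM normrN ler_wpM2r.
exists d => // s t su ut ts.
have /key : `|t - u| < d by rewrite ger0_norm; lra.
have /key : `|s - u| < d by rewrite ler0_norm; lra.
rewrite !(addrC u) !subrK => A B.
have -> : f t - f s - l * (t - s) =
  (f t - f u - l * (t - u)) - (f s - f u - l * (s - u)) by ring.
apply: le_trans (ler_normB _ _) _; apply: le_trans (lerD B A) _.
by rewrite ger0_norm ?ler0_norm; lra.
Qed.

Lemma straddle_cst f u df eps : straddle_derive f u df -> 0 < eps ->
  exists2 delta, 0 < delta & forall s t, s <= u -> u <= t -> t - s < delta ->
    `|f t - f s| <= eps.
Proof.
move=> fu e0; have [d d0 H] := fu 1 ltr01.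
have D0 : 0 < 1 + `|df| by rewrite ltr_pwDl.
exists (Num.min d (eps / (1 + `|df|))).
  by rewrite lt_min d0 divr_gt0.
move=> s t su ut; rewrite lt_min => /andP[ts1 ts2].
have -> : f t - f s = (f t - f s - df * (t - s)) + df * (t - s) by ring.
apply: le_trans (ler_normD _ _) _.
apply: le_trans (lerD (H _ _ su ut ts1) (lexx _)) _.
have st : 0 <= t - s by lra.
rewrite normrM (ger0_norm st) -mulrDl.
by move: ts2; rewrite ltr_pdivlMr// mulrC => /ltW.
Qed.

(** Continuous induction on the points [x] with [f x - f a <= eps * (x - a)]. A point of this set
    within [d / 3] of its supremum is compared directly with a point beyond the supremum, so it
    never has to be decided beforehand whether the supremum belongs to the set. *)
Lemma straddle_nonincreasing f a b : a <= b ->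
  (forall u eps, a <= u -> u <= b -> 0 < eps -> exists2 delta, 0 < delta &
    forall s t, a <= s -> s <= u -> u <= t -> t <= b -> t - s < delta ->
      f t - f s <= eps * (t - s)) ->
  f b <= f a.
Proof.
move=> ab H.
suff K eps : 0 < eps -> f b - f a <= eps * (b - a).
  rewrite -subr_le0; apply/ler_addgt0Pr => e e0; rewrite add0r.
  have [ba|] := ltP a b; last first.
    move=> ba; have /eqP -> : b == a by rewrite eq_le ba ab.
    by rewrite subrr ltW.
  have c0 : 0 < e / (b - a) by rewrite divr_gt0 ?subr_gt0.
  by apply: le_trans (K _ c0) _; rewrite divfK ?subr_eq0 ?gt_eqF.
move=> e0.
pose S := [set x | a <= x <= b /\ f x - f a <= eps * (x - a)].
have Sa : S a by split; [rewrite lexx ab | rewrite !subrr mulr0].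
have hS : has_sup S by split; [exists a | exists b => x [/andP[]]].
have ac : a <= sup S by apply: sup_upper_bound.
have cb : sup S <= b by apply: ge_sup; [exists a | move=> x [/andP[]]].
have [d d0 Hd] := H _ _ ac cb e0.
have d3 : 0 < d / 3 by rewrite divr_gt0.
have [x [/andP[ax xb] fx] xc] := sup_adherent d3 hS.
have xS : x <= sup S by apply: sup_upper_bound => //; split; rewrite ?ax.
pose t := Num.min b (sup S + d / 3).
have tb : t <= b by rewrite ge_min lexx.
have td : t <= sup S + d / 3 by rewrite ge_min lexx orbT.
have ct : sup S <= t by rewrite le_min cb lerDl ltW.
have St : S t.
  split; first by rewrite tb (le_trans ac).
  have := Hd _ _ ax xS ct tb; have xtd : t - x < d by lra.
  move=> /(_ xtd); lra.
have tS : t <= sup S by apply: sup_upper_bound.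
have bt : t = b.
  by move: tS; rewrite /t; case: (leP b (sup S + d / 3)) => // _ ?; exfalso; lra.
by move: St => [_]; rewrite bt.
Qed.

End Straddle.

(** * Truncated geometric distributions *)

Section QInteger.
Variable R : realType.
Implicit Types (t : R) (m i j : nat).

Definition qint m t : R := \sum_(k < m) t ^+ k.
(** The derivative of [qint m]; at [k = 0] the coefficient cancels the truncated exponent. *)
Definition dqint m t : R := \sum_(k < m) k%:R * t ^+ k.-1.

Lemma qint0 t : qint 0 t = 0. Proof. by rewrite /qint big_ord0. Qed.

Lemma qintS m t : qint m.+1 t = qint m t + t ^+ m.
Proof. by rewrite /qint big_ord_recr. Qed.

Lemma qintSl m t : qint m.+1 t = 1 + t * qint m t.
Proof.
elim: m => [|m IH]; first by rewrite qintS qint0 mulr0 addrC.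
by rewrite qintS [in LHS]IH [in RHS]qintS exprS; ring.
Qed.

Lemma dqintS m t : dqint m.+1 t = dqint m t + m%:R * t ^+ m.-1.
Proof. by rewrite /dqint big_ord_recr. Qed.

Lemma qint1r m : qint m 1 = m%:R.
Proof.
rewrite /qint (eq_bigr (fun=> 1)) => [|k _]; last by rewrite expr1n.
by rewrite sumr_const card_ord.
Qed.

Lemma dqint1r m : dqint m 1 = 2^-1 * m%:R * (m%:R - 1).
Proof.
elim: m => [|m IH]; first by rewrite /dqint big_ord0 mulr0 mul0r.
by rewrite dqintS IH expr1n -natr1; field.
Qed.

Lemma qint_mulB m t : (t - 1) * qint m t = t ^+ m - 1.
Proof. by rewrite subrX1. Qed.

Lemma qint_ge0 m t : 0 <= t -> 0 <= qint m t.
Proof. by move=> t0; apply: sumr_ge0 => k _; rewrite exprn_ge0. Qed.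

Lemma qint_gt0 m t : 0 <= t -> (0 < m)%N -> 0 < qint m t.
Proof.
by case: m => // m t0 _; rewrite qintSl ltr_pwDl// mulr_ge0// qint_ge0.
Qed.

Lemma le_qint m m' t : 0 <= t -> (m <= m')%N -> qint m t <= qint m' t.
Proof.
move=> t0; elim: m' => [|m' IH]; first by rewrite leqn0 => /eqP->.
rewrite leq_eqVlt => /orP[/eqP->//|/IH H].
by rewrite qintS (le_trans H)// lerDl exprn_ge0.
Qed.

Lemma qint_inv m t : t != 0 -> t ^+ m * qint m.+1 t^-1 = qint m.+1 t.
Proof.
move=> t0; elim: m => [|m IH]; first by rewrite !qintSl !qint0 expr0; ring.
rewrite qintS mulrDr exprVn divff ?expf_neq0// exprS -mulrA IH.
by rewrite [RHS]qintSl addrC.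
Qed.

Lemma dqint_mulB m t : (t - 1) * dqint m t = m%:R * t ^+ m.-1 - qint m t.
Proof.
elim: m => [|m IH]; first by rewrite /dqint big_ord0 qint0; ring.
rewrite dqintS mulrDr IH qintS -natr1 /=.
by case: m {IH} => [|m] /=; rewrite ?exprS; ring.
Qed.

Lemma is_derive_qint m t : is_derive t 1 (qint m) (dqint m t).
Proof.
rewrite /qint /dqint.
have -> : (fun x : R => \sum_(k < m) x ^+ k) = \sum_(k < m) (fun x => x ^+ k).
  by apply/funext => x; rewrite fct_sumE.
apply: is_derive_sum => k.
apply: DeriveDef; first exact: exprn_derivable.
by rewrite exp_derive scaler1.
Qed.

(** The forward equation without denominators: divided by [qint i t ^+ 2], it says that the flux
    from [j] to [j + 1] is minus the time derivative of [geom_cdf i j]. The rate has a removable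
    singularity at [t = 1], which is treated apart. *)
Lemma mallows_rate_qint i j t : 0 <= t -> (j < i)%N ->
  mallows_rate i j t * (t ^+ j * qint i t) =
  qint j.+1 t * dqint i t - dqint j.+1 t * qint i t.
Proof.
move=> t0 ji; have i0 : qint i t != 0.
  by rewrite gt_eqF// qint_gt0// (leq_ltn_trans _ ji).
rewrite /mallows_rate; case: eqVneq => [->|t1].
  rewrite !qint1r !dqint1r expr1n -subnDA addn1 natrB//; by field.
have t10 : t - 1 != 0 by rewrite subr_eq0.
have t10' : 1 - t != 0 by rewrite subr_eq0 eq_sym.
apply: (mulIf t10); rewrite -!qint_mulB.
rewrite [RHS](_ : _ = qint j.+1 t * ((t - 1) * dqint i t)
  - (t - 1) * dqint j.+1 t * qint i t); last by ring.
rewrite !dqint_mulB /=.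
have -> : t ^+ i.-1 = t ^+ (i - j - 1) * t ^+ j.
  by rewrite -exprD; congr (_ ^+ _); lia.
by field; rewrite t10 i0 t10'.
Qed.

Lemma mallows_rate_last i t : 0 <= t -> mallows_rate i.+1 i t = 0.
Proof.
move=> t0; rewrite /mallows_rate subSnn subnn.
case: eqVneq => [_|t1]; first by rewrite mulr0.
rewrite expr0 mulr1 -mulrA divff ?mulr1 ?subrr ?mulr0 // -qint_mulB.
rewrite mulf_neq0// ?subr_eq0// gt_eqF// qint_gt0//.
Qed.

End QInteger.

(** From [1 - x <= expR (- x)] one gets [expR x <= 1 / (1 - x)], which lies below the quadratic for
    [x <= 1/2]. *)
Lemma expR_le1D2 (R : realType) (x : R) : `|x| <= 2^-1 ->
  expR x <= 1 + x + 2 * x ^+ 2.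
Proof.
rewrite ler_norml => /andP[_ x2].
have x1 : 0 < 1 - x by lra.
have H : 1 - x <= expR (- x) by rewrite expR_ge1Dx.
have := expR_gt0 x; have := expRxMexpNx_1 x.
move: (expR x) (expR (- x)) H => y z H yz y0.
have y1 : y * (1 - x) <= 1 by rewrite -[leRHS]yz ler_wpM2l// ltW.
have : y * (1 - x) <= (1 + x + 2 * x ^+ 2) * (1 - x).
  apply: le_trans y1 _; rewrite -subr_ge0.
  have -> : (1 + x + 2 * x ^+ 2) * (1 - x) - 1 = x ^+ 2 * (1 - 2 * x) by ring.
  by rewrite mulr_ge0 ?sqr_ge0//; lra.
by rewrite ler_pM2r.
Qed.

Section TruncatedGeometric.
Variable R : realType.
Implicit Types (t : R) (m i j : nat).

Definition geom_cdf i j t : R := qint j.+1 t / qint i t.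
Definition geom_pmf i j t : R := t ^+ j / qint i t.

Lemma geom_cdfS i j t : geom_cdf i j.+1 t = geom_cdf i j t + geom_pmf i j.+1 t.
Proof. by rewrite /geom_cdf qintS mulrDl. Qed.

Lemma is_derive_qint_div a i t : 0 <= t -> (0 < i)%N ->
  is_derive t 1 (fun x => qint a x / qint i x)
    ((dqint a t * qint i t - qint a t * dqint i t) / qint i t ^+ 2).
Proof.
move=> t0 i0; have q0 : qint i t != 0 by rewrite gt_eqF// qint_gt0.
have H1 := is_derive_qint a t; have H2 := is_derive_qint i t.
have H3 := is_deriveV q0 H2.
apply: (is_derive_eq (is_deriveM H1 H3)).
rewrite /GRing.scale /=; field; exact: q0.
Qed.

Lemma is_derive_geom_cdf i j t : 0 <= t -> (j < i)%N ->
  is_derive t 1 (geom_cdf i j) (- (mallows_rate i j t * geom_pmf i j t)).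
Proof.
move=> t0 ji; have i0 : (0 < i)%N by apply: leq_ltn_trans ji.
have q0 : qint i t != 0 by rewrite gt_eqF// qint_gt0.
apply: (is_derive_eq (is_derive_qint_div j.+1 t0 i0)).
rewrite -opprB -mallows_rate_qint// /geom_pmf; field; exact: q0.
Qed.

Lemma straddle_geom_pmf i j t : 0 <= t -> (0 < i)%N ->
  exists df, straddle_derive (geom_pmf i j) t df.
Proof.
move=> t0 i0; eexists; apply: is_derive_straddle.
have -> : geom_pmf i j = (fun x => qint j.+1 x / qint i x) -
   (fun x => qint j x / qint i x).
  by apply/funext => x; rewrite !fctE qintS mulrDl addrC addKr.
by apply: is_deriveB; exact: is_derive_qint_div.
Qed.

Lemma dqint_ge0 m t : 0 <= t -> 0 <= dqint m t.
Proof. by move=> t0; apply: sumr_ge0 => k _; rewrite mulr_ge0// exprn_ge0. Qed.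

Lemma dqint_le m i t : 0 <= t -> (m <= i)%N ->
  t * dqint m t <= i%:R * qint m t.
Proof.
move=> t0; elim: m => [|m IH] mi; first by rewrite /dqint big_ord0 qint0 !mulr0.
rewrite dqintS qintS !mulrDr lerD ?IH// 1?ltnW// mulrCA.
case: m {IH} mi => [|m] mi /=; first by rewrite mul0r mulr_ge0.
by rewrite -exprS ler_wpM2r ?exprn_ge0// ler_nat ltnW.
Qed.

(** Equivalently, [qint m / qint i] is nonincreasing in [t]: mass only moves upwards, so the jump
    rates are nonnegative. *)
Lemma qint_dqint_ge0 m i t : 0 <= t -> (m <= i)%N ->
  dqint m t * qint i t <= qint m t * dqint i t.
Proof.
move=> t0; elim: i => [|i IH]; first by rewrite leqn0 => /eqP->; rewrite mulrC.
rewrite leq_eqVlt => /orP[/eqP->|]; first by rewrite mulrC.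
rewrite ltnS => mi; rewrite dqintS qintS !mulrDr lerD ?IH//.
case: i {IH} mi => [|i] mi /=.
  by move: mi; rewrite leqn0 => /eqP->; rewrite /dqint big_ord0 qint0 !mul0r.
rewrite exprS mulrA [dqint _ _ * t]mulrC [leRHS]mulrA ler_wpM2r ?exprn_ge0//.
by rewrite [leRHS]mulrC dqint_le.
Qed.

Lemma mallows_rate_ge0 i j t : 0 <= t -> (j < i)%N -> 0 <= mallows_rate i j t.
Proof.
move=> t0 ji; have i0 : (0 < i)%N by apply: leq_ltn_trans ji.
(* The factor [t ^+ j] in [mallows_rate_qint] can vanish at [t = 0]; there the rate is read off its
   formula, and [0 ^+ 0] occurs exactly when [i = j.+1]. *)
move: t0; rewrite le_eqVlt => /orP[/eqP<-|t0]; last first.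
  have tq : 0 < t ^+ j * qint i t by rewrite mulr_gt0 ?exprn_gt0 ?qint_gt0// ltW.
  rewrite -(pmulr_lge0 _ tq) (mallows_rate_qint (ltW t0) ji) subr_ge0.
  by rewrite qint_dqint_ge0// ltW.
rewrite /mallows_rate eq_sym oner_eq0 subr0 invr1 mul1r !expr0n /=.
rewrite [(i == 0)%N]gtn_eqF// !sub0r -mulrA divff ?oppr_eq0 ?oner_eq0// mulr1.
case: eqVneq => [e|_]; last by rewrite mulr0 subr0.
by rewrite mulr1 (_ : i = j.+1) ?subrr//; lia.
Qed.

Section Bounds.
Variables (K : R) (i : nat) (t : R).
Hypotheses (i0 : (0 < i)%N) (t0 : 0 < t).
Hypothesis tK : forall k, (k <= i)%N -> K^-1 <= t ^+ k <= K.

Let K1 : 1 <= K. Proof. by have /andP[_] := tK (leq0n i); rewrite expr0. Qed.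
Let K0 : 0 < K. Proof. exact: lt_le_trans K1. Qed.

Lemma qint_bounds m : (m <= i.+1)%N -> m%:R / K <= qint m t <= m%:R * K.
Proof.
elim: m => [|m IH] mi; first by rewrite qint0 !mul0r lexx.
rewrite qintS -natr1 !mulrDl !mul1r.
have /andP[H1 H2] := IH (ltnW mi); have /andP[H3 H4] := tK mi.
by rewrite !lerD.
Qed.

Lemma dqint_bound : dqint i t <= i%:R ^+ 2 * K.
Proof.
rewrite /dqint; apply: (@le_trans _ _ (\sum_(k < i) i%:R * K)).
  apply: ler_sum => k _; apply: ler_pM => //; first by rewrite exprn_ge0// ltW.
    by rewrite ler_nat ltnW.
  by have /andP[] : K^-1 <= t ^+ k.-1 <= K by apply: tK; have := ltn_ord k; lia.
by rewrite sumr_const card_ord -[leLHS]mulr_natl mulrA expr2.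
Qed.

Let iR : 0 < i%:R :> R. Proof. by rewrite ltr0n. Qed.
Let qi : i%:R / K <= qint i t. Proof. by have /andP[] := qint_bounds (leqnSn i). Qed.

Lemma geom_pmf_ge0 j : 0 <= geom_pmf i j t.
Proof. by rewrite divr_ge0 ?exprn_ge0 ?qint_ge0 ?ltW. Qed.

Lemma geom_pmf_bound j : (j <= i)%N -> geom_pmf i j t <= K ^+ 2 / i%:R.
Proof.
move=> ji; have qi0 : 0 < qint i t by rewrite qint_gt0// ltW.
have /andP[_ tj] := tK ji; rewrite /geom_pmf ler_pdivrMr//.
apply: le_trans tj _; apply: (@le_trans _ _ (K ^+ 2 / i%:R * (i%:R / K))).
  by rewrite le_eqVlt; apply/orP; left; apply/eqP; field; rewrite !gt_eqF.
by rewrite ler_wpM2l// divr_ge0 ?sqr_ge0// ltW.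
Qed.

Lemma mallows_rate_bound j : (j < i)%N -> mallows_rate i j t <= K ^+ 4 * i%:R ^+ 2.
Proof.
move=> ji; have qi0 : 0 < qint i t by rewrite qint_gt0// ltW.
have tj0 : 0 < t ^+ j by rewrite exprn_gt0.
have H : mallows_rate i j t * (t ^+ j * qint i t) <= i%:R ^+ 3 * K ^+ 2.
  rewrite (mallows_rate_qint (ltW t0) ji).
  apply: (@le_trans _ _ (qint j.+1 t * dqint i t)).
    by rewrite gerBl mulr_ge0 ?qint_ge0 ?dqint_ge0 ?(ltW t0).
  rewrite (_ : i%:R ^+ 3 * K ^+ 2 = (i%:R * K) * (i%:R ^+ 2 * K)); last by ring.
  apply: ler_pM; rewrite ?dqint_bound ?qint_ge0 ?dqint_ge0 ?(ltW t0)//.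
  apply: (@le_trans _ _ (qint i t)); first by rewrite le_qint// ltW.
  by have /andP[] := qint_bounds (leqnSn i).
have L : i%:R / K ^+ 2 <= t ^+ j * qint i t.
  rewrite (_ : i%:R / K ^+ 2 = K^-1 * (i%:R / K)); last by field; rewrite gt_eqF.
  have /andP[H1 _] := tK (ltnW ji).
  by apply: ler_pM => //; rewrite ?divr_ge0 ?invr_ge0 ?ltW.
have r0 : 0 <= mallows_rate i j t by rewrite mallows_rate_ge0// ltW.
have : mallows_rate i j t * (i%:R / K ^+ 2) <= i%:R ^+ 3 * K ^+ 2.
  by apply: le_trans H; rewrite ler_wpM2l.
have c0 : 0 < i%:R / K ^+ 2 by rewrite divr_gt0 ?exprn_gt0.
rewrite -ler_pdivlMr// => /le_trans; apply.
by rewrite le_eqVlt; apply/orP; left; apply/eqP; field; rewrite !gt_eqF.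
Qed.

(* Up to second order terms, the compensator of [geom_cdf i (Y t) t] vanishes
   because consecutive atoms have the ratio [t], which is close to [1]. *)
Lemma chernoff_generator_bound theta j : (j < i)%N ->
  `|theta| * (K ^+ 2 / i%:R) <= 2^-1 -> i%:R * `|t - 1| <= K ->
  - theta * (mallows_rate i j t * geom_pmf i j t) +
    mallows_rate i j t * (expR (theta * geom_pmf i j.+1 t) - 1) <=
  `|theta| * K ^+ 7 + 2 * theta ^+ 2 * K ^+ 8.
Proof.
move=> ji th it.
have r0 : 0 <= mallows_rate i j t by rewrite mallows_rate_ge0// ltW.
have rb := mallows_rate_bound ji.
have p0 := geom_pmf_ge0 j; have pb := geom_pmf_bound (ltnW ji).
have q0 := geom_pmf_ge0 j.+1; have qb := geom_pmf_bound ji.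
have qp : geom_pmf i j.+1 t = t * geom_pmf i j t by rewrite /geom_pmf exprS mulrA.
set r := mallows_rate i j t in r0 rb *.
set p := geom_pmf i j t in p0 pb qp *; set q := geom_pmf i j.+1 t in q0 qb qp *.
have e : expR (theta * q) <= 1 + theta * q + 2 * (theta * q) ^+ 2.
  apply: expR_le1D2; rewrite normrM (ger0_norm q0).
  by apply: le_trans th; rewrite ler_wpM2l.
apply: (@le_trans _ _ (theta * (r * p * (t - 1)) + 2 * theta ^+ 2 * (r * q ^+ 2))).
  apply: (@le_trans _ _ (- theta * (r * p) + r * (theta * q + 2 * (theta * q) ^+ 2))).
    by rewrite lerD2l ler_wpM2l// lerBlDl addrA.
  by rewrite qp le_eqVlt; apply/orP; left; apply/eqP; ring.
apply: lerD.
  apply: le_trans (ler_norm _) _; rewrite normrM ler_wpM2l//.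
  rewrite normrM (ger0_norm (mulr_ge0 r0 p0)).
  apply: (@le_trans _ _ ((K ^+ 4 * i%:R ^+ 2) * (K ^+ 2 / i%:R) * `|t - 1|)).
    by rewrite ler_wpM2r// ler_pM.
  rewrite (_ : _ * _ * _ = K ^+ 6 * (i%:R * `|t - 1|)); last first.
    by field; rewrite gt_eqF.
  by rewrite [K ^+ 7]exprSr ler_wpM2l// exprn_ge0// ltW.
have h0 : 0 <= 2 * theta ^+ 2 by rewrite mulr_ge0// sqr_ge0.
rewrite (ler_wpM2l h0)//.
apply: (@le_trans _ _ ((K ^+ 4 * i%:R ^+ 2) * (K ^+ 2 / i%:R) ^+ 2)).
  by rewrite ler_pM// ?sqr_ge0// lerXn2r// nnegrE// divr_ge0 ?exprn_ge0 ?ltW.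
by rewrite le_eqVlt; apply/orP; left; apply/eqP; field; rewrite gt_eqF.
Qed.

End Bounds.
End TruncatedGeometric.

(** * Birth processes *)

Lemma uniform_delta (R : realType) (n : nat) (Q : nat -> R -> Prop) :
  (forall j x y, y <= x -> Q j x -> Q j y) ->
  (forall j, exists2 x, 0 < x & Q j x) ->
  exists2 x, 0 < x & forall j, (j < n)%N -> Q j x.
Proof.
move=> mono H; elim: n => [|n [x x0 Hx]]; first by exists 1.
have [y y0 Hy] := H n; exists (Num.min x y); first by rewrite lt_min x0.
move=> j; rewrite ltnS leq_eqVlt => /orP[/eqP->|/Hx].
  by apply: mono Hy; rewrite ge_min lexx orbT.
by apply: mono; rewrite ge_min lexx.
Qed.

(** Only the masses at [j] and [j + 1] are known up to [e]; since the total mass is 1, all other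
    atoms together weigh at most [2 * e]. In the last state the atom [j + 1] is out of range, whence
    the condition that [h] vanishes there. *)
Lemma jump_expectation (R : realType) m (j : nat) (c f : nat -> R) h e B :
  (j < m)%N -> (forall k, 0 <= c k) -> \sum_(k < m) c k = 1 ->
  `|c j - (1 - h)| <= e -> `|c j.+1 - h| <= e -> (j.+1 = m -> h = 0) ->
  (forall k, (k < m)%N -> `|f k| <= B) ->
  `|\sum_(k < m) f k * c k - (f j + h * (f j.+1 - f j))| <= B * (4 * e).
Proof.
move=> jm c0 c1 cj cj1 hm fB.
have B0 : 0 <= B by apply: le_trans (fB _ jm).
have e0 : 0 <= e by apply: le_trans cj.
have rest (p : pred 'I_m) : `|\sum_(k < m | p k) f k * c k| <=
    B * \sum_(k < m | p k) c k.
  apply: le_trans (ler_norm_sum _ _ _) _; rewrite mulr_sumr ler_sum// => k _.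
  by rewrite normrM (ger0_norm (c0 _)) ler_wpM2r// fB.
have [jm1|jm1] := ltnP j.+1 m; last first.
  have /hm h0 : j.+1 = m by lia.
  move: cj c1; rewrite h0 subr0 mul0r addr0.
  rewrite (bigD1 (Ordinal jm))//= => cj c1; rewrite (bigD1 (Ordinal jm))//=.
  have r := rest (fun k => k != Ordinal jm).
  have -> : f j * c j + \sum_(i < m | i != Ordinal jm) f i * c i - f j =
    f j * (c j - 1) + \sum_(i < m | i != Ordinal jm) f i * c i by ring.
  apply: le_trans (ler_normD _ _) _; rewrite normrM.
  have : \sum_(i < m | i != Ordinal jm) c i <= e.
    by move: cj; rewrite ler_norml; lra.
  move=> /(ler_wpM2l B0) H.
  have : `|f j| * `|c j - 1| <= B * e by rewrite ler_pM// fB.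
  have Be : 0 <= B * e by rewrite mulr_ge0.
  lra.
have jne : Ordinal jm1 != Ordinal jm by rewrite -val_eqE /= gtn_eqF.
move: c1; rewrite (bigD1 (Ordinal jm))//= (bigD1 (Ordinal jm1) jne)/= => c1.
rewrite (bigD1 (Ordinal jm))//= (bigD1 (Ordinal jm1) jne)/=.
pose p := fun k => (k != Ordinal jm) && (k != Ordinal jm1).
have r := rest p.
rewrite -/p in c1 *.
set S := \sum_(i < m | _) _ in r *.
rewrite [X in X <= _](_ : _ =
  `|f j * (c j - (1 - h)) + f j.+1 * (c j.+1 - h) + S|); last by congr `|_|; ring.
apply: le_trans (ler_normD _ _) _.
apply: le_trans (lerD (ler_normD _ _) (lexx _)) _; rewrite !normrM.
have : \sum_(i < m | p i) c i <= 2 * e.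
  by move: cj cj1; rewrite !ler_norml; lra.
move=> /(ler_wpM2l B0) H.
have : `|f j| * `|c j - (1 - h)| <= B * e by rewrite ler_pM// fB.
have : `|f j.+1| * `|c j.+1 - h| <= B * e by rewrite ler_pM// fB.
lra.
Qed.

(** * Real-valued probabilities *)

Section RealProbability.
Context (R : realType) (d : measure_display) (Omega : measurableType d).
Variable P : probability Omega R.
Implicit Types A B : set Omega.

Definition pr A : R := fine (P A).

Lemma prK A : measurable A -> P A = (pr A)%:E.
Proof. by move=> mA; rewrite /pr fineK// fin_num_measure. Qed.

Lemma pr_ge0 A : 0 <= pr A.
Proof. by rewrite fine_ge0. Qed.

Lemma pr_le1 A : measurable A -> pr A <= 1.
Proof. by move=> mA; rewrite -lee_fin -prK// probability_le1. Qed.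

Lemma prT : pr setT = 1.
Proof. by rewrite /pr probability_setT. Qed.

Lemma prU A B : measurable A -> measurable B -> A `&` B = set0 ->
  pr (A `|` B) = pr A + pr B.
Proof.
by move=> mA mB AB; rewrite /pr measureU// fineD// fin_num_measure.
Qed.

Lemma le_pr A B : measurable A -> measurable B -> A `<=` B -> pr A <= pr B.
Proof.
by move=> mA mB AB; rewrite -lee_fin -!prK// le_measure// inE.
Qed.

Lemma pr_partition A m (Z : Omega -> nat) : measurable A ->
  (forall k, measurable [set w | Z w = k]) -> (forall w, (Z w < m)%N) ->
  pr A = \sum_(k < m) pr (A `&` [set w | Z w = k]).
Proof.
move=> mA mZ Zm.
have mlt k : measurable [set w | (Z w < k)%N].
  elim: k => [|k IH]; first by rewrite (_ : mkset _ = set0)//; apply/seteqP; split.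
  rewrite (_ : mkset _ = [set w | (Z w < k)%N] `|` [set w | Z w = k]).
    exact: measurableU.
  by apply/seteqP; split => w /=; lia.
transitivity (pr (A `&` [set w | (Z w < m)%N])).
  by congr pr; apply/seteqP; split => w //=; case.
elim: m {Zm} => [|m IH].
  by rewrite big_ord0 (_ : _ `&` _ = set0) /pr ?measure0//; apply/seteqP; split => w // [].
rewrite big_ord_recr /= -IH -prU; first last.
- by apply/seteqP; split => w //= [[_ h] [_ e]]; move: h; rewrite e ltnn.
- exact: measurableI.
- exact: measurableI.
congr pr; rewrite -setIUr; congr (_ `&` _).
by apply/seteqP; split => w /=; lia.
Qed.

End RealProbability.

Section BirthProcess.
Context (R : realType) (d : measure_display) (Omega : measurableType d).
Variables (P : probability Omega R) (m : nat) (q : nat -> R -> R).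
Variable Y : R -> Omega -> nat.
Hypothesis HY : birth_process P m q Y.
Hypothesis q_last : forall u, 0 <= u -> q m.-1 u = 0.

Lemma measurable_birth_level t k : 0 <= t -> measurable [set w | Y t w = k].
Proof.
move=> t0; rewrite (_ : mkset _ = setT `&` Y t @^-1` [set k]); last by rewrite setTI.
by apply: (birth_measurable HY t0).
Qed.

Lemma sub_sigma_of (D D' : set R) : D `<=` D' -> sigma_of Y D `<=` sigma_of Y D'.
Proof.
move=> DD; apply: sub_sigma_algebra2 => _ [u Du [k _ <-]].
by exists u; [exact: DD | exists k].
Qed.

Lemma measurable_sigma_of (D : set R) A : (forall u, D u -> 0 <= u) ->
  sigma_of Y D A -> measurable A.
Proof.
move=> D0; apply: smallest_sub; first exact: sigma_algebra_measurable.
by move=> _ [u Du [k _ <-]]; apply: measurable_birth_level; exact: D0.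
Qed.

Definition occupation (A : set Omega) t k : R := pr P (A `&` [set w | Y t w = k]).

Lemma occupation_ge0 A t k : 0 <= occupation A t k.
Proof. exact: pr_ge0. Qed.

Lemma sum_occupation A t : measurable A -> 0 <= t ->
  \sum_(k < m) occupation A t k = pr P A.
Proof.
move=> mA t0; rewrite -pr_partition// => [k|w].
  exact: measurable_birth_level.
exact: birth_range HY _ _ t0.
Qed.

(* The bound is uniform in [f], so that [f] may depend on [s] and [t]. *)
Lemma forward_step A s0 u eps : 0 <= s0 -> s0 <= u -> sigma_of Y `[0, s0] A ->
  0 < eps -> exists2 delta, 0 < delta & forall s t,
    s0 <= s -> s <= u -> u <= t -> t - s < delta ->
    forall (f : nat -> R) B, (forall k, (k < m)%N -> `|f k| <= B) ->
    `|\sum_(k < m) f k * occupation A t k -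
      \sum_(j < m) occupation A s j *
        (f j + q j u * (t - s) * (f j.+1 - f j))| <= B * eps * (t - s).
Proof.
move=> s00 s0u sA e0.
have u0 : 0 <= u by apply: le_trans s0u.
have mA : measurable A.
  apply: measurable_sigma_of sA => v /=; rewrite in_itv /= => /andP[] //.
have e4 : 0 < eps / 4 by rewrite divr_gt0.
have [delta d0 Hd] := @uniform_delta R m
  (fun j x => forall s t : R, 0 <= s -> s <= u -> u <= t -> s < t -> t - s < x ->
    (0 < P [set w | Y s w = j])%E ->
    `|cond_prob P [set w | Y t w = j.+1] [set w | Y s w = j]
        - q j u * (t - s)| <= eps / 4 * (t - s) /\
    `|cond_prob P [set w | Y t w = j] [set w | Y s w = j]
        - (1 - q j u * (t - s))| <= eps / 4 * (t - s))
  (fun j x y yx H s t s0 su ut st tsy =>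
     H s t s0 su ut st (lt_le_trans tsy yx))
  (fun j => birth_has_rate HY j u0 e4).
exists delta => // s t s0s su ut tsd f B fB.
have s00' : 0 <= s by apply: le_trans s0s.
have t0 : 0 <= t by lra.
have [st|] := ltP s t; last first.
  move=> ts; have -> : t = s by lra.
  rewrite subrr mulr0 normr_le0 subr_eq0; apply/eqP; apply: eq_bigr => k _.
  by rewrite mulr0 mul0r addr0 mulrC.
have mY v k : 0 <= v -> measurable [set w | Y v w = k] by exact: measurable_birth_level.
have ts0 : 0 <= t - s by lra.
pose c j k := pr P ((A `&` [set w | Y s w = j]) `&` [set w | Y t w = k]).
have mAs j : measurable (A `&` [set w | Y s w = j]).
  by apply: measurableI => //; exact: mY.
have step (j : 'I_m) : `|\sum_(k < m) f k * c j k - occupation A s j *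
     (f j + q j u * (t - s) * (f j.+1 - f j))| <=
     B * (4 * (eps / 4 * (t - s))) * occupation A s j.
  (* Rates are only known given events of positive probability; states of zero occupation contribute
     nothing on either side. *)
  have [z|nz] := eqVneq (occupation A s j) 0.
    rewrite z mul0r mulr0 subr0 big1 ?normr0// => k _.
    suff -> : c j k = 0 by rewrite mulr0.
    apply/eqP; rewrite eq_le pr_ge0 andbT -z le_pr//.
    by apply: measurableI => //; exact: mY.
  have oc0 : 0 < occupation A s j by rewrite lt_neqAle eq_sym nz pr_ge0.
  have PA0 : (0 < P (A `&` [set w | Y s w = j]))%E by rewrite prK// lte_fin.
  have Pj0 : (0 < P [set w | Y s w = j])%E.
    apply: lt_le_trans PA0 _; by rewrite le_measure ?inE//; exact: mY.
  have [H1 H2] := Hd _ (ltn_ord j) _ _ s00' su ut st tsd Pj0.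
  have sAs : sigma_of Y `[0, s] A.
    apply: sub_sigma_of sA => v /=; rewrite !in_itv /= => /andP[-> /=].
    by move=> /le_trans; apply.
  pose cp k := cond_prob P [set w | Y t w = k] [set w | Y s w = j].
  (* The Markov property removes [A] from the conditioning, and [birth_rate] controls what
     remains. *)
  have cE k : c j k = occupation A s j * cp k.
    rewrite /cp -(birth_markov HY _ s00' st sAs PA0) /cond_prob -/(pr P _).
    by rewrite -/(pr P (A `&` _)) -/(occupation A s j) mulrC divfK// setIC.
  have cp0 k : 0 <= cp k by rewrite divr_ge0// fine_ge0.
  have cp1 : \sum_(k < m) cp k = 1.
    apply: (mulfI nz); rewrite mulr1 mulr_sumr.
    rewrite (eq_bigr (fun k : 'I_m => c j k)) => [|k _]; last by rewrite cE.
    rewrite -pr_partition// => [k|w]; first exact: mY.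
    exact: birth_range HY _ _ t0.
  have hm : j.+1 = m -> q j u * (t - s) = 0.
    by move=> /(congr1 predn) /= ->; rewrite q_last ?mul0r.
  have := jump_expectation (ltn_ord j) cp0 cp1 H2 H1 hm fB.
  move=> /(ler_wpM2r (ltW oc0)); apply: le_trans.
  rewrite -[in leRHS](gtr0_norm oc0) -normrM mulrBl mulr_suml.
  rewrite le_eqVlt; apply/orP; left; apply/eqP; congr `|_ - _|; last exact: mulrC.
  by apply: eq_bigr => k _; rewrite cE mulrCA mulrC.
have -> : \sum_(k < m) f k * occupation A t k =
    \sum_(j < m) \sum_(k < m) f k * c j k.
  rewrite exchange_big; apply: eq_bigr => k _ /=; rewrite -mulr_sumr; congr (_ * _).
  rewrite /occupation (@pr_partition _ _ _ _ _ m (Y s)) => [|||w].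
  - by apply: eq_bigr => j _; rewrite /c setIAC.
  - by apply: measurableI => //; exact: mY.
  - by move=> j; exact: mY.
  - exact: birth_range HY _ _ s00'.
rewrite -sumrB; apply: le_trans (ler_norm_sum _ _ _) _.
apply: le_trans (ler_sum _ (fun j _ => step j)) _.
rewrite -mulr_sumr sum_occupation//.
have m0 : (0 < m)%N by have := birth_range HY point s00'; case: (m).
have B0 : 0 <= B by apply: le_trans (fB _ m0).
apply: (@le_trans _ _ (B * (4 * (eps / 4 * (t - s))) * 1)).
  by rewrite ler_wpM2l ?pr_le1// !mulr_ge0// ltW.
by rewrite le_eqVlt; apply/orP; left; apply/eqP; field.
Qed.

End BirthProcess.

Section TruncatedGeometricLemmas.
Variable R : realType.
Implicit Types (t : R) (i j : nat).

Lemma geom_cdf_ge0 i j t : 0 <= t -> 0 <= geom_cdf i j t.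
Proof. by move=> t0; rewrite divr_ge0 ?qint_ge0. Qed.

Lemma geom_cdf_le1 i j t : 0 <= t -> (j < i)%N -> geom_cdf i j t <= 1.
Proof.
move=> t0 ji; rewrite ler_pdivrMr ?qint_gt0 ?(leq_ltn_trans _ ji)// mul1r.
exact: le_qint.
Qed.

Lemma geom_pmf_le1 i j t : 0 <= t -> (j < i)%N -> geom_pmf i j t <= 1.
Proof.
move=> t0 ji; rewrite ler_pdivrMr ?qint_gt0 ?(leq_ltn_trans _ ji)// mul1r.
by apply: le_trans (le_qint t0 ji); rewrite qintS lerDr qint_ge0.
Qed.

End TruncatedGeometricLemmas.

(** * The marginal law of a left inversion count *)

Section MallowsBirth.
Context (R : realType) (d : measure_display) (Omega : measurableType d).
Variables (P : probability Omega R) (i : nat) (Y : R -> Omega -> nat).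
Hypothesis i0 : (0 < i)%N.
Hypothesis HY : birth_process P i (@mallows_rate R i) Y.

Let rate_last (u : R) : 0 <= u -> mallows_rate i i.-1 u = 0.
Proof. by case: i i0 => // i' _ u0; exact: mallows_rate_last. Qed.

Let mY t k : 0 <= t -> measurable [set w | Y t w = k].
Proof. exact: (measurable_birth_level HY). Qed.

(** By the induction hypothesis, the error [D] of the atom at [k] is also the error of the
    cumulative sum up to [k]. Comparing fluxes gives [D' = - p * D] with [p >= 0] and [D 0 = 0], so
    [D ^+ 2] is nonincreasing and vanishes; this replaces a uniqueness theorem for the forward
    equations. *)
Lemma birth_marginal_sum k t : (k <= i)%N -> 0 <= t ->
  \sum_(j < k) occupation P Y setT t j = qint k t / qint i t.
Proof.
elim: k t => [|k IH] t ki t0; first by rewrite big_ord0 qint0 mul0r.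
pose occ := occupation P Y setT.
pose D t := occ t k - geom_pmf i k t.
have DE v : 0 <= v -> D v = \sum_(j < k.+1) occ v j - geom_cdf i k v.
  by move=> v0; rewrite big_ord_recr /= IH ?(ltnW ki)// /D /geom_cdf /geom_pmf qintS mulrDl /occ;
    ring.
suff D0 : D t = 0.
  by rewrite -/occ big_ord_recr /= IH ?(ltnW ki)// qintS mulrDl; congr (_ + _);
    apply/eqP; rewrite -subr_eq0 -/(D t) D0.
have D1 v : 0 <= v -> `|D v| <= 1.
  move=> v0; have := occupation_ge0 P Y setT v k; rewrite -/(occ v k).
  have : occ v k <= 1 by rewrite pr_le1//; apply: measurableI => //; exact: mY.
  have := geom_pmf_le1 v0 ki.
  have : 0 <= geom_pmf i k v by rewrite divr_ge0 ?exprn_ge0 ?qint_ge0.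
  by rewrite /D ler_norml; lra.
have D00 : D 0 = 0.
  have q0 : qint i (0 : R) = 1 by case: (i) i0 => // i' _; rewrite qintSl mul0r addr0.
  rewrite /D /geom_pmf q0 divr1 expr0n /occ /occupation setTI.
  case: k {IH ki occ D DE D1} => [|k] /=.
    rewrite (_ : mkset _ = setT) ?prT ?subrr//; apply/seteqP; split => w //= _.
    exact: birth_start HY w.
  rewrite (_ : mkset _ = set0) ?subr0 /pr ?measure0//; apply/seteqP; split => w //=.
  by rewrite (birth_start HY).
suff : D t ^+ 2 <= D 0 ^+ 2 by rewrite D00 expr0n/= real_exprn_even_le0//=; move/eqP.
apply: (@straddle_nonincreasing R (fun v => D v ^+ 2) 0 t) => // u eps u0 ut e0.
set p := mallows_rate i k u.
have p0 : 0 <= p by rewrite mallows_rate_ge0.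
(* [C] collects the errors: one [e] each from the forward step and from the derivative of
   [geom_cdf], and [p * e] from freezing the atom at time [u]. The choices of [e] and [d4] leave
   [eps / 2] each for the first and the second order part of the increment of [D ^+ 2]. *)
pose C := p + 2.
have C0 : 0 < C by rewrite /C; lra.
pose e := Num.min 1 (eps / (4 * C)).
have e1 : e <= 1 by rewrite ge_min lexx.
have e2 : e <= eps / (4 * C) by rewrite ge_min lexx orbT.
have ep : 0 < e by rewrite lt_min ltr01 divr_gt0// mulr_gt0.
have sT : sigma_of Y `[0, 0] setT.
  by have [] := smallest_sigma_algebra setT
    [set [set w | Y v w = n] | v in `[(0 : R), 0] & n in [set: nat]]
    => h1 h2 h3; rewrite -setC0 -setTD; apply: h2.
have [d1 d10 H1] := forward_step HY rate_last (lexx 0) u0 sT ep.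
have [d2 d20 H2] := is_derive_straddle (is_derive_geom_cdf u0 ki) ep.
have [df Hdf] := straddle_geom_pmf k u0 i0.
have [d3 d30 H3] := straddle_cst Hdf ep.
pose d4 := eps / (8 * C ^+ 2).
have d40 : 0 < d4 by rewrite divr_gt0// mulr_gt0// exprn_gt0.
exists (Num.min (Num.min d1 d2) (Num.min d3 d4)).
  by rewrite !lt_min d10 d20 d30.
move=> s v s0 su uv vt; rewrite !lt_min => /andP[/andP[vs1 vs2] /andP[vs3 vs4]].
have v0 : 0 <= v by lra.
have h0 : 0 <= v - s by lra.
have f1 n : (n < i)%N -> `|(n <= k)%N%:R : R| <= 1.
  by move=> _; case: leqP; rewrite ?normr1 ?normr0.
have S v' : \sum_(j < i) (j <= k)%N%:R * occ v' j = \sum_(j < k.+1) occ v' j.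
  rewrite (big_ord_widen i (occ v') ki) [RHS]big_mkcond /=; apply: eq_bigr => j _.
  by rewrite ltnS; case: leqP; rewrite ?mul1r ?mul0r.
have F := H1 s v s0 su uv vs1 _ _ f1; rewrite -/occ S in F.
(* The test function is the indicator of [{0, ..., k}], which only the jump from [k] to [k + 1]
   changes. *)
have E2 : \sum_(j < i) occ s j *
    ((j <= k)%N%:R + mallows_rate i j u * (v - s) *
       ((j.+1 <= k)%N%:R - (j <= k)%N%:R)) =
    \sum_(j < k.+1) occ s j - p * (v - s) * occ s k.
  rewrite -S; under eq_bigr do rewrite mulrDr.
  rewrite big_split /=; congr (_ + _); first by apply: eq_bigr => j _; rewrite mulrC.
  rewrite (bigD1 (Ordinal ki))//= ltnn leqnn big1 /= ?addr0 => [|j jk].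
    by rewrite -/p sub0r mulrN1 mulrN mulrC.
  have : (j.+1 <= k)%N = (j <= k)%N.
    by rewrite [RHS]leq_eqVlt; move: jk; rewrite -val_eqE /= => /negbTE ->.
  by move=> ->; rewrite subrr !mulr0.
rewrite E2 mul1r in F.
have G := H2 s v su uv vs2; have Hs := H3 s u su (lexx _).
have {}Hs : `|geom_pmf i k u - geom_pmf i k s| <= e.
  by apply: Hs; lra.
rewrite -/p in G.
pose E := D v - D s + p * (v - s) * D s.
have EE : `|E| <= C * e * (v - s).
  have -> : E = (\sum_(j < k.+1) occ v j -
      (\sum_(j < k.+1) occ s j - p * (v - s) * occ s k)) -
    (geom_cdf i k v - geom_cdf i k s - - (p * geom_pmf i k u) * (v - s)) +
    p * (v - s) * (geom_pmf i k u - geom_pmf i k s).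
    rewrite /E (_ : _ * D s = p * (v - s) * (occ s k - geom_pmf i k s))//.
    by rewrite (DE v)// (DE s)//; ring.
  apply: le_trans (ler_normD _ _) _; apply: le_trans (lerD (ler_normB _ _) (lexx _)) _.
  rewrite normrM (ger0_norm (mulr_ge0 p0 h0)) /C.
  have : p * (v - s) * `|geom_pmf i k u - geom_pmf i k s| <= p * (v - s) * e.
    by rewrite ler_wpM2l// mulr_ge0.
  move: F G; lra.
have Ds := D1 s s0.
have DD : `|D v - D s| <= 2 * C * (v - s).
  have -> : D v - D s = E - p * (v - s) * D s by rewrite /E; ring.
  apply: le_trans (ler_normB _ _) _; rewrite normrM (ger0_norm (mulr_ge0 p0 h0)).
  have : p * (v - s) * `|D s| <= p * (v - s) * 1 by rewrite ler_wpM2l// mulr_ge0.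
  have : C * e * (v - s) <= C * 1 * (v - s) by rewrite ler_wpM2r// ler_wpM2l// ltW.
  move: EE; rewrite /C; lra.
have -> : D v ^+ 2 - D s ^+ 2 = 2 * (D s * E) - 2 * (p * (v - s) * D s ^+ 2) +
    (D v - D s) ^+ 2 by rewrite /E; ring.
have A1 : D s * E <= eps / 4 * (v - s).
  apply: le_trans (ler_norm _) _; rewrite normrM.
  apply: (@le_trans _ _ (1 * (C * e * (v - s)))); first by rewrite ler_pM.
  rewrite mul1r ler_wpM2r//.
  move: e2; rewrite ler_pdivlMr ?mulr_gt0//; lra.
have A2 : 0 <= p * (v - s) * D s ^+ 2 by apply: mulr_ge0; [exact: mulr_ge0 | exact: sqr_ge0].
have A3 : (D v - D s) ^+ 2 <= eps / 2 * (v - s).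
  rewrite -real_normK ?num_real//.
  apply: (@le_trans _ _ ((2 * C * (v - s)) ^+ 2)).
    by rewrite lerXn2r// nnegrE// !mulr_ge0// ltW.
  have -> : (2 * C * (v - s)) ^+ 2 = (4 * C ^+ 2 * (v - s)) * (v - s) by ring.
  rewrite ler_wpM2r//; move: vs4; rewrite /d4 ltr_pdivlMr ?mulr_gt0 ?exprn_gt0//.
  lra.
lra.
Qed.

Lemma birth_marginal k t : (k < i)%N -> 0 <= t ->
  pr P [set w | (Y t w <= k)%N] = geom_cdf i k t.
Proof.
move=> ki t0; rewrite /geom_cdf -birth_marginal_sum//.
have mk : measurable [set w | (Y t w <= k)%N].
  elim: k {ki} => [|k IH].
    by rewrite (_ : mkset _ = [set w | Y t w = 0%N]);
      [exact: mY | apply/seteqP; split => w /=; lia].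
  rewrite (_ : mkset _ = [set w | (Y t w <= k)%N] `|` [set w | Y t w = k.+1]).
    by apply: measurableU => //; exact: mY.
  by apply/seteqP; split => w /=; lia.
rewrite (pr_partition P mk (fun k => mY k t0) (fun w => birth_range HY w t0)).
rewrite (big_ord_widen i (occupation P Y setT t) ki) [RHS]big_mkcond /=.
apply: eq_bigr => j _; rewrite ltnS /occupation setTI; case: leqP => jk.
  by congr pr; apply/seteqP; split => w /= => [[]//|e]; rewrite e.
rewrite (_ : _ `&` _ = set0) /pr ?measure0//; apply/seteqP; split => w //= [h e].
by move: h; rewrite e leqNgt jk.
Qed.

End MallowsBirth.

(** Finitely many natural-valued variables take countably many joint values, so an arbitrary
    predicate [B] of them is a countable union of events. *)
Lemma measurable_nat_family (d : measure_display) (Omega : measurableType d)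
    (I : finType) (Z : I -> Omega -> nat) (B : (I -> nat) -> Prop) :
  (forall i k, measurable [set w | Z i w = k]) ->
  measurable [set w | B (fun i => Z i w)].
Proof.
move=> mZ; have -> : [set w | B (fun i => Z i w)] =
    \bigcup_(v : {ffun I -> nat})
      ([set _ | B v] `&` \bigcap_(i in [set: I]) [set w | Z i w = v i]).
  apply/seteqP; split => w /=.
    move=> Bw; exists [ffun i => Z i w] => //; split => /=; last first.
      by move=> i _ /=; rewrite ffunE.
    by rewrite (_ : (fun_of_fin _ : I -> nat) = fun i => Z i w)//; apply/funext => i;
      rewrite ffunE.
  by move=> [v _ [/= Bv H]]; rewrite (_ : (fun i => _) = v)//; apply/funext => i; exact: H.
apply: countable_bigcupT_measurable => [|v]; first exact: countableP.
apply: measurableI; last first.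
  by apply: fin_bigcap_measurable => // i _; exact: mZ.
have [Bv|Bv] := EM (B v).
  by rewrite (_ : mkset _ = setT)//; apply/seteqP; split.
by rewrite (_ : mkset _ = set0)//; apply/seteqP; split.
Qed.

Lemma last_index i j : (j < i)%N -> (i <= j.+1)%N -> j = i.-1.
Proof. lia. Qed.

(** * Exponential concentration in time *)

Section TimeConcentration.
Context (R : realType) (d : measure_display) (Omega : measurableType d).
Variables (P : probability Omega R) (i : nat) (Y : R -> Omega -> nat).
Hypothesis i0 : (0 < i)%N.
Hypothesis HY : birth_process P i (@mallows_rate R i) Y.
Variables (a b K theta : R).
Hypotheses (a0 : 0 < a) (ab : a <= b).
Hypothesis powK : forall t, a <= t -> t <= b ->
  forall k, (k <= i)%N -> K^-1 <= t ^+ k <= K.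
Hypothesis oneK : forall t, a <= t -> t <= b -> i%:R * `|t - 1| <= K.
Hypothesis thetaK : `|theta| * (K ^+ 2 / i%:R) <= 2^-1.

Let c := `|theta| * K ^+ 7 + 2 * theta ^+ 2 * K ^+ 8.

Let rate_last (u : R) : 0 <= u -> mallows_rate i i.-1 u = 0.
Proof. by case: i i0 => // i' _ u0; exact: mallows_rate_last. Qed.

Let mY t k : 0 <= t -> measurable [set w | Y t w = k].
Proof. exact: (measurable_birth_level HY). Qed.

Let K0 : 0 < K.
Proof.
have /andP[_] := powK (lexx a) ab (leq0n i); rewrite expr0.
exact: lt_le_trans.
Qed.

Let c0 : 0 <= c.
Proof.
by apply: addr_ge0; apply: mulr_ge0; rewrite ?exprn_ge0 ?(ltW K0)// mulr_ge0// sqr_ge0.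
Qed.

(** The decay at rate [c] compensates the growth permitted by [chernoff_generator_bound], so that
    [g (Y t) t] is a supermartingale on [[a, b]]. *)
Let g j t : R := expR (theta * geom_cdf i j t - c * (t - a)).

Lemma is_derive_tilt j (t : R) : 0 <= t -> (j < i)%N ->
  is_derive t 1 (g j) ((- theta * (mallows_rate i j t * geom_pmf i j t) - c) * g j t).
Proof.
move=> t0 ji; have H := is_derive_geom_cdf t0 ji.
have L : is_derive t 1 (theta \*: geom_cdf i j - c \*: (@id R - cst a))
    (theta *: (- (mallows_rate i j t * geom_pmf i j t)) - c *: (1 - 0)).
  by apply: is_deriveB; apply: is_deriveZ; apply: is_deriveB.
have E := is_derive1_comp (is_derive_expR _) L.
apply: (is_derive_eq E); rewrite /GRing.scale /= /g subr0 mulr1 mulrC.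
by congr (_ * _); ring.
Qed.

Lemma tiltS j t : g j.+1 t = g j t * expR (theta * geom_pmf i j.+1 t).
Proof. by rewrite /g -expRD geom_cdfS; congr expR; ring. Qed.

(** At [u] the generator applied to [g] is nonpositive. Continuity of [g] moves the jump term from
    [u] to [t], the form in which [forward_step] produces it for the test function [g _ t]. *)
Lemma tilted_step j u eps : (j < i)%N -> a <= u -> u <= b -> 0 < eps ->
  exists2 delta, 0 < delta & forall s t, s <= u -> u <= t -> t - s < delta ->
   g j t - g j s + mallows_rate i j u * (t - s) * (g j.+1 t - g j t) <=
   eps * (t - s).
Proof.
move=> ji au ub e0; have u0 : 0 < u by apply: lt_le_trans au.
have u0' := ltW u0.
pose p := mallows_rate i j u.
have p0 : 0 <= p by rewrite mallows_rate_ge0.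
have e2 : 0 < eps / 2 by rewrite divr_gt0.
have [d1 d10 H1] := is_derive_straddle (is_derive_tilt u0' ji) e2.
have gu0 : 0 <= g j u by rewrite expR_ge0.
have gen : (- theta * (p * geom_pmf i j u) - c) * g j u + p * (g j.+1 u - g j u) <= 0.
  have := chernoff_generator_bound i0 u0 (powK au ub) ji thetaK (oneK au ub).
  rewrite -/c -/p -subr_le0 => /(ler_wpM2r gu0); rewrite mul0r tiltS.
  apply: le_trans; rewrite le_eqVlt; apply/orP; left; apply/eqP; ring.
have [d2 d20 H2] : exists2 delta, 0 < delta & forall s t, s <= u -> u <= t ->
    t - s < delta -> p * (t - s) * (g j.+1 t - g j t) <=
      p * (t - s) * (g j.+1 u - g j u) + eps / 2 * (t - s).
  (* In the last state the rate is zero, and [g j.+1] is outside the range where its derivative is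
     known. *)
  have [ji1|ji1] := ltnP j.+1 i; last first.
    exists 1 => // s t su ut _; rewrite /p (last_index ji ji1) ?rate_last//.
    by rewrite !mul0r add0r mulr_ge0//; [exact: ltW | lra].
  pose e3 := eps / 4 / (p + 1).
  have p1 : 0 < p + 1 by lra.
  have e30 : 0 < e3 by rewrite !divr_gt0.
  have [d3 d30 H3] := straddle_cst (is_derive_straddle (is_derive_tilt u0' ji)) e30.
  have [d4 d40 H4] := straddle_cst (is_derive_straddle (is_derive_tilt u0' ji1)) e30.
  exists (Num.min d3 d4); first by rewrite lt_min d30.
  move=> s t su ut; rewrite lt_min => /andP[ts3 ts4].
  have tu3 : t - u < d3 by lra.
  have tu4 : t - u < d4 by lra.
  have ts0 : 0 <= t - s by lra.
  have {H3} := H3 u t (lexx _) ut tu3; have {H4} := H4 u t (lexx _) ut tu4.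
  rewrite !ler_norml => /andP[_ A] /andP[B _].
  have D : (g j.+1 t - g j t) - (g j.+1 u - g j u) <= 2 * e3 by lra.
  have pe : p * (2 * e3) <= eps / 2.
    apply: (@le_trans _ _ ((p + 1) * (2 * e3))).
      by apply: ler_wpM2r; [rewrite mulr_ge0// ltW | lra].
    by rewrite /e3 le_eqVlt; apply/orP; left; apply/eqP; field; rewrite gt_eqF.
  rewrite -lerBlDl -mulrBr.
  apply: le_trans (ler_wpM2l (mulr_ge0 p0 ts0) D) _.
  by rewrite mulrAC ler_wpM2r.
exists (Num.min d1 d2); first by rewrite lt_min d10.
move=> s t su ut; rewrite lt_min => /andP[ts1 ts2].
have ts0 : 0 <= t - s by lra.
have {H2} := H2 s t su ut ts2; have {H1} := H1 s t su ut ts1.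
rewrite ler_norml => /andP[_ A] B; rewrite -/p in A *.
have := ler_wpM2r ts0 gen; rewrite mul0r; lra.
Qed.

(** The supermartingale inequality started from a known state at time [a]: the expectation [phi] of
    [g] on this event is nonincreasing by [straddle_nonincreasing]. *)
Lemma tilted_occupation j0 : (j0 < i)%N ->
  \sum_(k < i) g k b * occupation P Y [set w | Y a w = j0] b k <=
  g j0 a * pr P [set w | Y a w = j0].
Proof.
move=> ji; pose A := [set w | Y a w = j0]; pose occ := occupation P Y A.
have a0' := ltW a0.
have mA : measurable A by exact: mY.
have -> : g j0 a * pr P A = \sum_(k < i) g k a * occ a k.
  rewrite (bigD1 (Ordinal ji))//= big1 ?addr0 => [|k kj].
    by rewrite /occ /occupation setIid.
  rewrite /occ /occupation (_ : _ `&` _ = set0) /pr ?measure0 ?mulr0//.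
  apply/seteqP; split => w // [] /= -> e; move: kj; rewrite -val_eqE /= e eqxx //.
pose phi t := \sum_(k < i) g k t * occ t k.
apply: (@straddle_nonincreasing R phi a b) => // u eps au ub e0.
have u0 : 0 <= u by lra.
pose B := expR `|theta|.
have B0 : 0 < B by exact: expR_gt0.
have gB t k : a <= t -> (k < i)%N -> `|g k t| <= B.
  move=> at_ ki; have t0 : 0 <= t by lra.
  rewrite ger0_norm ?expR_ge0// ler_expR.
  have h : 0 <= c * (t - a) by rewrite mulr_ge0// subr_ge0.
  have : theta * geom_cdf i k t <= `|theta|.
    apply: le_trans (ler_norm _) _; rewrite normrM (ger0_norm (geom_cdf_ge0 i k t0)).
    by rewrite -[leRHS]mulr1 ler_wpM2l// geom_cdf_le1.
  lra.
have e2 : 0 < eps / 2 by rewrite divr_gt0.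
have eB : 0 < eps / 2 / B by rewrite divr_gt0.
have sA : sigma_of Y `[0, a] A.
  apply: sub_sigma_algebra; exists a; first by rewrite /= in_itv /= a0' lexx.
  by exists j0.
have [d1 d10 H1] := forward_step HY rate_last a0' au sA eB.
(* A delta is requested for every natural [j]; from [i] on the claim is vacuous and 1 serves. *)
have [d2 d20 H2] := @uniform_delta R i
  (fun j x => (j < i)%N -> forall s t, s <= u -> u <= t -> t - s < x ->
   g j t - g j s + mallows_rate i j u * (t - s) * (g j.+1 t - g j t) <=
   eps / 2 * (t - s))
  (fun j x y yx H ij s t su ut tsy => H ij s t su ut (lt_le_trans tsy yx))
  (fun j => match boolP (j < i)%N with
    | AltTrue ij => let: ex_intro2 x x0 Hx := tilted_step ij au ub e2 in
        ex_intro2 _ _ x x0 (fun _ => Hx)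
    | AltFalse nij => ex_intro2 _ _ 1 ltr01 (fun ij => False_ind _ (negP nij ij)) end).
exists (Num.min d1 d2); first by rewrite lt_min d10.
move=> s t as_ su ut tb; rewrite lt_min => /andP[ts1 ts2].
have ts0 : 0 <= t - s by lra.
have at_ : a <= t by lra.
have := H1 s t as_ su ut ts1 _ B (fun k => gB t k at_).
rewrite -/occ ler_norml => /andP[_ F].
rewrite -/(phi t) in F.
have B2 : B * (eps / 2 / B) = eps / 2 by field; rewrite gt_eqF.
rewrite B2 in F.
have : \sum_(j < i) occ s j * (g j t + mallows_rate i j u * (t - s) *
   (g j.+1 t - g j t)) - phi s <= eps / 2 * (t - s).
  rewrite -sumrB; apply: (@le_trans _ _ (\sum_(j < i) occ s j * (eps / 2 * (t - s)))).
    apply: ler_sum => j _; rewrite [g j s * _]mulrC -mulrBr ler_wpM2l//.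
      exact: occupation_ge0.
    have := H2 j (ltn_ord j) (ltn_ord j) s t su ut ts2; lra.
  rewrite -mulr_suml (sum_occupation HY)//; last by lra.
  by rewrite -[leRHS]mul1r ler_wpM2r ?pr_le1// mulr_ge0// ltW.
lra.
Qed.

(** Markov's inequality for the exponential, on each event [Y a = j] separately because
    [tilted_occupation] starts from a fixed state; the bounds are then summed over [j]. *)
Lemma time_chernoff x :
  pr P [set w | x <= theta * (geom_cdf i (Y b w) b - geom_cdf i (Y a w) a)] <=
  expR (c * (b - a) - x).
Proof.
have a0' := ltW a0; have b0 : 0 <= b by apply: le_trans ab.
set E := [set w | _].
have mE : measurable E.
  pose Z (z : bool) := if z then Y b else Y a.
  apply: (@measurable_nat_family _ _ bool Z (fun v =>
    x <= theta * (geom_cdf i (v true) b - geom_cdf i (v false) a))).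
  by case=> k; exact: mY.
rewrite (pr_partition P mE (fun k => mY k a0') (fun w => birth_range HY w a0')).
have mA j : measurable [set w | Y a w = j] by exact: mY.
apply: (@le_trans _ _ (\sum_(j < i) expR (c * (b - a) - x) *
    pr P [set w | Y a w = j])); last first.
  rewrite -mulr_sumr ler_piMr ?expR_ge0//.
  rewrite -(prT P) (pr_partition P measurableT (fun k => mY k a0')
    (fun w => birth_range HY w a0')).
  by apply: ler_sum => j _; rewrite setTI.
apply: ler_sum => j _.
have ea : 0 < expR (theta * geom_cdf i j a + x) by exact: expR_gt0.
rewrite -(ler_pM2l ea) [leRHS]mulrA -expRD.
rewrite (_ : _ + x + _ = c * (b - a) + theta * geom_cdf i j a); last by ring.
apply: (@le_trans _ _ (expR (c * (b - a)) * (g j a * pr P [set w | Y a w = j])));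
  last by rewrite [leLHS]mulrA -expRD /g subrr mulr0 subr0.
apply: le_trans (ler_wpM2l (expR_ge0 _) (tilted_occupation (ltn_ord j))).
have mEj : measurable (E `&` [set w | Y a w = j]) by apply: measurableI.
rewrite (pr_partition P mEj (fun k => mY k b0) (fun w => birth_range HY w b0)).
rewrite !mulr_sumr; apply: ler_sum => k _.
rewrite [leRHS]mulrA -expRD /g.
rewrite (_ : c * (b - a) + _ = theta * geom_cdf i k b); last by ring.
have mJ : measurable ([set w | Y a w = j] `&` [set w | Y b w = k]).
  by apply: measurableI; exact: mY.
have [xl|xl] := boolP (x <= theta * (geom_cdf i k b - geom_cdf i j a)).
  apply: ler_pM; rewrite ?expR_ge0 ?pr_ge0//; first by rewrite ler_expR; lra.
  by apply: le_pr => //; [apply: measurableI => //; exact: mY | move=> w [[]]].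
rewrite (_ : _ `&` _ = set0) /pr ?measure0 ?mulr0.
  by rewrite mulr_ge0 ?expR_ge0// fine_ge0.
apply/seteqP; split => // w [[/= Ew e1] e2]; move: xl; rewrite -e1 -e2.
by rewrite (_ : x <= _).
Qed.

End TimeConcentration.

(** * Recovering a permutation from its left inversions *)

(* If [r] of the indices below [k] have a larger image than a fixed index
   [i < k], then the image of [k] is larger than that of [i] iff [l k <= r],
   where [l k] is the number of left inversions of [k]. *)
Fixpoint chain (l : nat -> nat) (k r m : nat) : nat :=
  if m is m'.+1 then chain l k.+1 (r + (l k <= r)%N) m' else r.

Lemma leq_chain l l' k r r' m : (r <= r')%N -> (forall j, (l' j <= l j)%N) ->
  (chain l k r m <= chain l' k r' m)%N.
Proof.
move=> + ll; elim: m k r r' => //= m IH k r r' rr; apply: IH.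
have := ll k; case: (leqP (l k) r); case: (leqP (l' k) r'); lia.
Qed.

Lemma chain_bound l k r m : (r < k)%N -> (chain l k r m < k + m)%N.
Proof.
elim: m k r => [|m IH] k r rk /=; first by rewrite addn0.
by rewrite -addSnnS IH//; case: (l k <= r)%N; rewrite ?addn0 ?addn1// ltnW.
Qed.

(** Lets [chain] run along the naturals; the default 0 is never read as long as the chain stops at
    [n]. *)
Definition ord_fun n (l : 'I_n -> nat) (k : nat) : nat := oapp l 0%N (insub k).

Lemma ord_funE n (l : 'I_n -> nat) (k : 'I_n) : ord_fun l k = l k.
Proof. by rewrite /ord_fun valK. Qed.

Section PermutationChain.
Variables (n : nat) (s : 'S_n) (i : 'I_n).

Let rk k := #|[pred j : 'I_n | (j < k)%N && (s i < s j)%N]|.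

(** If [s i < s k], every left inversion of [k] is counted by [rk k]. Otherwise the inclusion is
    reversed, and strict because [i] itself is a left inversion of [k]. *)
Lemma left_inversions_leq (k : 'I_n) : (i < k)%N ->
  (left_inversions s k <= rk k)%N = (s i < s k)%N.
Proof.
move=> ik; have [sik|ski] := ltnP (s i) (s k).
  apply: subset_leq_card; apply/fintype.subsetP => j; rewrite !inE => /andP[-> /=].
  exact: ltn_trans.
apply/negbTE; rewrite -ltnNge; apply: proper_card; apply/fintype.properP; split.
  apply/fintype.subsetP => j; rewrite !inE => /andP[-> /=]; exact: leq_ltn_trans.
exists i; rewrite !inE ik ?ltnn//= ltn_neqAle ski andbT.
by apply: contraTneq ik => /val_inj /perm_inj ->; rewrite ltnn.
Qed.

Lemma rankS (k : 'I_n) : rk k.+1 = (rk k + (s i < s k))%N.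
Proof.
rewrite /rk -!sum1_card (bigID (pred1 k)) /= addnC; congr (_ + _)%N.
  apply: eq_bigl => j; rewrite !inE ltnS leq_eqVlt -val_eqE /=.
  by case: (ltngtP j k) => //=; rewrite ?andbF ?andbT.
rewrite (eq_bigl (fun j => (j == k) && (s i < s k)%N)).
  by rewrite big_mkcondr big_pred1_eq; case: (s i < s k)%N.
by move=> j; rewrite !inE andbC; case: eqVneq => // ->; rewrite ltnSn.
Qed.

Lemma chain_rank k m : (i < k)%N -> (k + m <= n)%N ->
  chain (ord_fun (left_inversions s)) k (rk k) m = rk (k + m).
Proof.
elim: m k => [|m IH] k ik kn; first by rewrite addn0.
have kn' : (k < n)%N by apply: leq_trans kn; rewrite addnS ltnS leq_addr.
rewrite /= -[in ord_fun _ k]/(nat_of_ord (Ordinal kn')) ord_funE.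
rewrite -[in rk k]/(nat_of_ord (Ordinal kn')) left_inversions_leq// -rankS IH//=.
- by rewrite addSnnS.
- exact: ltnW.
- by rewrite addSnnS.
Qed.

Lemma perm_chain : chain (ord_fun (left_inversions s)) i.+1 (left_inversions s i)
  (n - i.+1) = (n - (s i).+1)%N.
Proof.
have <- : rk i.+1 = left_inversions s i.
  by rewrite rankS ltnn addn0.
rewrite chain_rank//; last by rewrite subnKC.
rewrite subnKC// /rk.
transitivity (\sum_(j < n) (s i < s j)%N)%N.
  by rewrite -sum1_card big_mkcond /=; apply: eq_bigr => j _; rewrite inE ltn_ord;
    case: (s i < s j)%N.
transitivity (\sum_(j < n) (s i < j)%N)%N.
  by rewrite [RHS](reindex_inj (@perm_inj _ s)).
elim: n (nat_of_ord (s i)) => [|m IH] a; first by rewrite big_ord0.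
rewrite big_ord_recr /= IH; case: (ltnP a m); lia.
Qed.

End PermutationChain.

(** * The law of the chain at a fixed time *)

Section ChainLaw.
Context (R : realType) (d : measure_display) (Omega : measurableType d).
Variables (P : probability Omega R) (n : nat) (Z : 'I_n -> Omega -> nat).
Hypothesis mZ : forall i k, measurable [set w | Z i w = k].
Hypothesis indepZ : forall b : 'I_n -> nat -> bool,
  pr P [set w | forall i, b i (Z i w)] = \prod_(i < n) pr P [set w | b i (Z i w)].

Fixpoint chain_law (F : nat -> nat -> R) (test : nat -> bool) k r m : R :=
  if m is m'.+1 then F k r * chain_law F test k.+1 r.+1 m'
    + (1 - F k r) * chain_law F test k.+1 r m'
  else (test r)%:R.

(** Independence is available as a product rule, so the induction carries a product event [b]
    recording the decisions at coordinates already passed. Splitting on whether coordinate [k] is at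
    most [r] multiplies the product by [F k r] or [1 - F k r]. *)
Lemma pr_chain_and (F : nat -> nat -> R) (test : nat -> bool) k r m
    (b : 'I_n -> nat -> bool) : (k + m = n)%N ->
  (forall (i : 'I_n) r, (r <= i)%N -> pr P [set w | (Z i w <= r)%N] = F i r) ->
  (r < k)%N -> (forall (i : 'I_n) v, (k <= i)%N -> b i v) ->
  pr P [set w | (forall i, b i (Z i w)) /\
    test (chain (ord_fun (Z^~ w)) k r m)] =
  (\prod_(i < n) pr P [set w | b i (Z i w)]) * chain_law F test k r m.
Proof.
move=> + HF; elim: m k r b => [|m IH] k r b kmn rk bk.
  rewrite /=; case: (test r); rewrite ?mulr1 ?mulr0 -?indepZ.
    by congr pr; apply/seteqP; split => w /= => [[]|].
  by rewrite (_ : mkset _ = set0) /pr ?measure0//; apply/seteqP; split => w //= [].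
have kn : (k < n)%N by rewrite -kmn addnS ltnS leq_addr.
pose K := Ordinal kn.
pose b1 i v := if i == K then (v <= r)%N else b i v.
pose b0 i v := if i == K then (r < v)%N else b i v.
have mE (c : 'I_n -> nat -> bool) k' r' m' : measurable [set w |
    (forall i, c i (Z i w)) /\ test (chain (ord_fun (Z^~ w)) k' r' m')].
  exact: (@measurable_nat_family _ _ _ Z (fun v => (forall i, c i (v i)) /\
    test (chain (ord_fun v) k' r' m'))).
have -> : [set w | (forall i, b i (Z i w)) /\
    test (chain (ord_fun (Z^~ w)) k r m.+1)] =
  [set w | (forall i, b1 i (Z i w)) /\ test (chain (ord_fun (Z^~ w)) k.+1 r.+1 m)]
  `|` [set w | (forall i, b0 i (Z i w)) /\ test (chain (ord_fun (Z^~ w)) k.+1 r m)].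
  have oK w : ord_fun (Z^~ w) k = Z K w by exact: (ord_funE (Z^~ w) K).
  apply/seteqP; split => w /=; rewrite oK.
    move=> [H]; have [h|h] := leqP (Z K w) r; rewrite ?addn1 ?addn0 => T.
      by left; split => // i; rewrite /b1; case: eqVneq => // ->.
    by right; split => // i; rewrite /b0; case: eqVneq => // ->.
  have bE c : (forall i, i != K -> c i -> b i (Z i w)) -> (forall i, c i) ->
      forall i, b i (Z i w).
    by move=> H Hc i; have [->|iK] := eqVneq i K; [exact: bk | exact: H].
  move=> [[H T]|[H T]].
    have h : (Z K w <= r)%N by have := H K; rewrite /b1 eqxx.
    rewrite h addn1; split=> //; apply: (bE (fun i => b1 i (Z i w))) => // i.
    by rewrite /b1 => /negbTE ->.
  have h : (r < Z K w)%N by have := H K; rewrite /b0 eqxx.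
  rewrite leqNgt h addn0; split=> //; apply: (bE (fun i => b0 i (Z i w))) => // i.
  by rewrite /b0 => /negbTE ->.
rewrite prU//; last first.
  apply/seteqP; split => w //= [[H _] [H' _]]; have := H K; have := H' K.
  by rewrite /b0 /b1 eqxx ltnNge => /negP.
have km : (k.+1 + m = n)%N by rewrite addSnnS.
have bk1 (i : 'I_n) v : (k.+1 <= i)%N -> b1 i v /\ b0 i v.
  move=> ki; rewrite /b1 /b0 -val_eqE /= gtn_eqF//; split; apply: bk; exact: ltnW.
rewrite IH//; [|by move=> i v /(bk1 i v)[]].
rewrite IH//; [|exact: ltnW|by move=> i v /(bk1 i v)[]].
set p := \prod_(i < n | i != K) pr P [set w | b i (Z i w)].
have -> : \prod_(i < n) pr P [set w | b i (Z i w)] = p.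
  rewrite (bigD1 K)//= -/p (_ : pr P _ = 1) ?mul1r// -(prT P).
  by congr pr; apply/seteqP; split => w //= _; apply: bk.
have -> : \prod_(i < n) pr P [set w | b1 i (Z i w)] = F k r * p.
  rewrite (bigD1 K)//= {1}/b1 eqxx HF ?(ltnW rk)//; congr (_ * _).
  by apply: eq_bigr => i /negbTE iK; rewrite /b1 iK.
have -> : \prod_(i < n) pr P [set w | b0 i (Z i w)] = (1 - F k r) * p.
  rewrite (bigD1 K)//= {1}/b0 eqxx; congr (_ * _); last first.
    by apply: eq_bigr => i /negbTE iK; rewrite /b0 iK.
  rewrite -(HF K r (ltnW rk)) -(prT P).
  have mk (c : pred nat) : measurable [set w | c (Z K w)].
    exact: (@measurable_nat_family _ _ unit (fun _ => Z K) (fun v => c (v tt))).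
  have := prU P (mk (fun v => (v <= r)%N)) (mk (fun v => (r < v)%N)).
  rewrite (_ : _ `|` _ = setT); last first.
    by apply/seteqP; split => w //= _; case: (leqP (Z K w) r); [left|right].
  move=> -> //; first by rewrite addrC addKr.
  by apply/seteqP; split => w //= [h1 h2]; move: h1; rewrite leqNgt h2.
rewrite /=; ring.
Qed.

Lemma pr_chain (F : nat -> nat -> R) (test : nat -> bool) k r m : (k + m = n)%N ->
  (forall (i : 'I_n) r, (r <= i)%N -> pr P [set w | (Z i w <= r)%N] = F i r) ->
  (r < k)%N ->
  pr P [set w | test (chain (ord_fun (Z^~ w)) k r m)] = chain_law F test k r m.
Proof.
move=> kmn HF rk; have := @pr_chain_and F test k r m (fun _ _ => true) kmn HF rk.
rewrite big1 ?mul1r => [|i _]; last first.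
  by rewrite -(prT P); congr pr; apply/seteqP; split.
by move=> <- //; congr pr; apply/seteqP; split => w /= => [|[]].
Qed.

End ChainLaw.

(** * Exponential concentration along the chain *)

Section ChainChernoff.
Variables (R : realType) (K q theta : R) (n k0 : nat).
Hypotheses (q0 : 0 < q) (k0_gt0 : (0 < k0)%N).
Hypothesis powK : forall k, (k <= n)%N -> K^-1 <= q^-1 ^+ k <= K.
Hypothesis thetaK : `|theta| * (K ^+ 2 / k0%:R) <= 2^-1.

(* With independent truncated geometric left inversions, this is an exact
   martingale along [chain]: see [chain_martingaleE]. *)
Definition chain_martingale k r : R := qint r.+1 q^-1 / qint k.+1 q^-1.

Let p0 : 0 < q^-1. Proof. by rewrite invr_gt0. Qed.
Let K1 : 1 <= K. Proof. by have /andP[] := powK (leq0n n); rewrite expr0. Qed.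
Let K0 : 0 < K. Proof. exact: lt_le_trans K1. Qed.

Lemma geom_cdf_inv k r : (r <= k)%N ->
  geom_cdf k.+1 r q * q^-1 ^+ r.+1 = q^-1 ^+ k.+1 * qint r.+1 q^-1 / qint k.+1 q^-1.
Proof.
move=> rk; have qq : q != 0 by rewrite gt_eqF.
have h0 : qint k.+1 q^-1 != 0 by rewrite gt_eqF// qint_gt0// ltW.
rewrite /geom_cdf -!(qint_inv _ qq) !exprVn.
rewrite !exprS; field.
by rewrite h0 qq !expf_neq0.
Qed.

(** The zero-based coordinate [k] has [k + 1] possible values, whence [geom_cdf k.+1]. With
    [p = q^-1], an upward step gains [p ^+ r.+1 / qint k.+2 p]; by [geom_cdf_inv] its mean exactly
    offsets the change of denominator from [qint k.+1 p] to [qint k.+2 p]. *)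
Lemma chain_martingaleE k r : (r <= k)%N ->
  geom_cdf k.+1 r q * chain_martingale k.+1 r.+1 +
  (1 - geom_cdf k.+1 r q) * chain_martingale k.+1 r = chain_martingale k r.
Proof.
move=> rk; set F := geom_cdf _ _ _.
have h0 : qint k.+1 q^-1 != 0 by rewrite gt_eqF// qint_gt0// ltW.
have h1 : qint k.+2 q^-1 != 0 by rewrite gt_eqF// qint_gt0// ltW.
rewrite /chain_martingale [qint r.+2 _]qintS.
rewrite (_ : _ + _ = (qint r.+1 q^-1 + F * q^-1 ^+ r.+1) / qint k.+2 q^-1); last by ring.
rewrite geom_cdf_inv// [qint k.+2 _]qintS; field.
by rewrite h0 -qintS h1.
Qed.

(** The current value is a convex combination of the two possible next ones, so both lie within
    their distance, at most [K ^+ 2 / k0], of it. In the quadratic bound for the exponential the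
    linear terms average to zero. *)
Lemma chain_chernoff_step k r : (k0 <= k)%N -> (k < n)%N -> (r <= k)%N ->
  geom_cdf k.+1 r q * expR (theta * chain_martingale k.+1 r.+1) +
  (1 - geom_cdf k.+1 r q) * expR (theta * chain_martingale k.+1 r) <=
  expR (theta * chain_martingale k r + 2 * theta ^+ 2 * (K ^+ 2 / k0%:R) ^+ 2).
Proof.
move=> k0k kn rk.
have F0 : 0 <= geom_cdf k.+1 r q by rewrite geom_cdf_ge0// ltW.
have F1 : geom_cdf k.+1 r q <= 1 by rewrite geom_cdf_le1// ltW.
have ME := chain_martingaleE rk.
have k0R : 0 < k0%:R :> R by rewrite ltr0n.
have D0 : chain_martingale k.+1 r <= chain_martingale k.+1 r.+1.
  by rewrite ler_wpM2r ?invr_ge0 ?qint_ge0 ?le_qint// ltW.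
have D1 : chain_martingale k.+1 r.+1 - chain_martingale k.+1 r <= K ^+ 2 / k0%:R.
  rewrite /chain_martingale -mulrBl qintS addrAC subrr add0r.
  have /andP[_ h] : K^-1 <= q^-1 ^+ r.+1 <= K by apply: powK; apply: leq_ltn_trans kn.
  have /andP[h' _] : k.+2%:R / K <= qint k.+2 q^-1 <= k.+2%:R * K.
    by apply: (qint_bounds powK).
  have qk0 : 0 < qint k.+2 q^-1 by apply: qint_gt0 => //; exact: ltW.
  rewrite (ler_pdivrMr _ _ qk0); apply: le_trans h _.
  apply: (@le_trans _ _ (K ^+ 2 / k0%:R * (k0%:R / K))).
    by rewrite le_eqVlt; apply/orP; left; apply/eqP; field; rewrite !gt_eqF.
  rewrite ler_wpM2l ?divr_ge0 ?sqr_ge0 ?(ltW k0R)//; apply: le_trans h'.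
  by rewrite ler_wpM2r ?invr_ge0 ?(ltW K0)// ler_nat; do 2 apply: leqW.
have thK := thetaK; move: ME D0 D1; set F := geom_cdf _ _ _ in F0 F1 *.
set M1 := chain_martingale k.+1 r.+1; set M0 := chain_martingale k.+1 r.
set M := chain_martingale k r; set D := K ^+ 2 / k0%:R in thK * => ME D0 D1.
have FD0 : 0 <= F * (M1 - M0) by rewrite mulr_ge0// subr_ge0.
have FD1 : 0 <= (1 - F) * (M1 - M0) by rewrite mulr_ge0// subr_ge0.
have key M' : `|M' - M| <= D -> expR (theta * M') <=
    expR (theta * M) * (1 + theta * (M' - M) + 2 * theta ^+ 2 * D ^+ 2).
  move=> MD; have -> : theta * M' = theta * M + theta * (M' - M) by ring.
  rewrite expRD ler_wpM2l ?expR_ge0//.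
  apply: le_trans (expR_le1D2 _) _.
    rewrite normrM; apply: le_trans thK.
    by rewrite ler_wpM2l.
  rewrite lerD2l exprMn mulrA ler_wpM2l//; first by rewrite mulr_ge0// sqr_ge0.
  by rewrite -real_normK ?num_real// lerXn2r// nnegrE ?normr_ge0//;
    exact: le_trans (normr_ge0 _) MD.
have A1 : `|M1 - M| <= D by rewrite ler_norml; lra.
have A0 : `|M0 - M| <= D by rewrite ler_norml; lra.
have G0 : 0 <= 1 - F by rewrite subr_ge0.
apply: le_trans (lerD (ler_wpM2l F0 (key _ A1)) (ler_wpM2l G0 (key _ A0))) _.
rewrite expRD [leLHS](_ : _ = expR (theta * M) * (1 + theta * (F * M1 + (1 - F) * M0 - M)
    + 2 * theta ^+ 2 * D ^+ 2)); last by ring.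
by rewrite ME subrr mulr0 addr0 ler_wpM2l ?expR_ge0// expR_ge1Dx.
Qed.

Lemma chain_law_chernoff x k r m : (k0 <= k)%N -> (k + m = n)%N -> (r < k)%N ->
  chain_law (fun k r => geom_cdf k.+1 r q)
    (fun r => x <= theta * chain_martingale n r) k r m <=
  expR (theta * chain_martingale k r - x +
    m%:R * (2 * theta ^+ 2 * (K ^+ 2 / k0%:R) ^+ 2)).
Proof.
set c := 2 * theta ^+ 2 * _; move=> + + +; elim: m k r => [|m IH] k r k0k kmn rk.
  rewrite /= mul0r addr0 -kmn addn0.
  case: (leP x) => h /=; rewrite ?expR_ge0//.
  by apply: le_trans (expR_ge1Dx _); lra.
have F0 : 0 <= geom_cdf k.+1 r q by rewrite geom_cdf_ge0// ltW.
have F1 : 0 <= 1 - geom_cdf k.+1 r q.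
  by rewrite subr_ge0 geom_cdf_le1// 1?ltnW// ltW.
have kn : (k < n)%N by rewrite -kmn addnS ltnS leq_addr.
rewrite /=.
have H1 := IH k.+1 r.+1 (leqW k0k); rewrite addSnnS kmn in H1.
have {}H1 := H1 erefl rk.
have H0 := IH k.+1 r (leqW k0k); rewrite addSnnS kmn in H0.
have {}H0 := H0 erefl (ltnW rk).
apply: le_trans (lerD (ler_wpM2l F0 H1) (ler_wpM2l F1 H0)) _.
have := chain_chernoff_step k0k kn (ltnW rk); rewrite -/c.
move=> /(ler_wpM2r (expR_ge0 (- x + m%:R * c))); rewrite mulrDl -!mulrA -!expRD.
rewrite -natr1 !addrA.
move=> H; apply: le_trans (le_trans H _).
  by [].
by rewrite ler_expR; lra.
Qed.

End ChainChernoff.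

Lemma dist_trans (R : realDomainType) (y x z a b : R) :
  `|x - y| <= a -> `|y - z| <= b -> `|x - z| <= a + b.
Proof. by move=> H1 H2; apply: le_trans (ler_distD y _ _) _; exact: lerD. Qed.

Lemma distr_le (R : realDomainType) (x y a : R) : `|x - y| <= a -> `|y - x| <= a.
Proof. by rewrite distrC. Qed.

(** * From discrete paths to the limit *)

Section ExpRBounds.
Variable R : realType.
Implicit Types u v M : R.

Lemma expR_dist_le u v M : u <= M -> v <= M ->
  `|expR u - expR v| <= expR M * `|u - v|.
Proof.
wlog uv : u v / v <= u => [H|uM vM].
  by have [|/ltW] := leP v u => [/H//|/H]; rewrite distrC [`|u - v|]distrC => H' *; exact: H'.
rewrite !ger0_norm ?subr_ge0 ?ler_expR//.
apply: (@le_trans _ _ (expR u * (u - v))); last first.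
  by rewrite ler_wpM2r ?subr_ge0// ler_expR.
have := ler_wpM2l (expR_ge0 u) (expR_ge1Dx (v - u)).
by rewrite -expRD (_ : u + (v - u) = v); [lra | ring].
Qed.

Lemma expR_dist_ge u v M : M <= u -> M <= v ->
  expR M * `|u - v| <= `|expR u - expR v|.
Proof.
wlog uv : u v / v <= u => [H|uM vM].
  by have [|/ltW] := leP v u => [/H//|/H]; rewrite distrC [`|expR u - _|]distrC => H' *; exact: H'.
rewrite !ger0_norm ?subr_ge0 ?ler_expR//.
apply: (@le_trans _ _ (expR v * (u - v))).
  by rewrite ler_wpM2r ?subr_ge0// ler_expR.
have := ler_wpM2l (expR_ge0 v) (expR_ge1Dx (u - v)).
by rewrite -expRD (_ : v + (u - v) = u); [lra | ring].
Qed.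

End ExpRBounds.

Section Moebius.
Variable R : realType.
Implicit Types c w L : R.

(* [moebius (q ^+ i)] exchanges the scales of [geom_cdf] and of
   [chain_martingale]: see [qratio_inv]. *)
Definition moebius c w : R := c * w / (1 - w + c * w).

(** The denominator is a convex combination of 1 and [c]. *)
Lemma moebius_den c w L : 1 <= L -> L^-1 <= c -> 0 <= w <= 1 ->
  L^-1 <= 1 - w + c * w.
Proof.
move=> L1 Lc /andP[w0 w1]; have L0 : 0 < L by lra.
have Li : L^-1 <= 1 by rewrite invf_le1.
have : L^-1 * w <= c * w by rewrite ler_wpM2r.
have : L^-1 * (1 - w) <= 1 * (1 - w) by rewrite ler_wpM2r// subr_ge0.
lra.
Qed.

Lemma moebius_ge0_le1 c w : 0 < c -> 0 <= w <= 1 -> 0 <= moebius c w <= 1.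
Proof.
move=> c0 /andP[w0 w1]; have cw0 : 0 <= c * w by rewrite mulr_ge0// ltW.
have [d0|d0] := eqVneq (1 - w + c * w) 0; first by rewrite /moebius d0 invr0 mulr0 lexx ler01.
have d1 : 0 < 1 - w + c * w by rewrite lt_neqAle eq_sym d0; lra.
by rewrite /moebius divr_ge0 ?(ltW d1)//= ler_pdivrMr// mul1r; lra.
Qed.

Lemma moebius_lipschitz c w w' L : 1 <= L -> L^-1 <= c <= L ->
  0 <= w <= 1 -> 0 <= w' <= 1 ->
  `|moebius c w - moebius c w'| <= L ^+ 3 * `|w - w'|.
Proof.
move=> L1 /andP[Lc cL] w01 w01'; have L0 : 0 < L by lra.
have h := moebius_den L1 Lc w01; have h' := moebius_den L1 Lc w01'.
have Li : 0 < L^-1 by rewrite invr_gt0.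
have c0 : 0 < c by apply: lt_le_trans Lc.
set d := 1 - w + c * w in h; set d' := 1 - w' + c * w' in h'.
have d0 : 0 < d by apply: lt_le_trans h.
have d0' : 0 < d' by apply: lt_le_trans h'.
have -> : moebius c w - moebius c w' = c * (d^-1 * d'^-1) * (w - w').
  rewrite /moebius -/d -/d'; rewrite /d /d' in d0 d0' *; field.
  by rewrite !gt_eqF.
rewrite normrM ler_wpM2r// ger0_norm; last by rewrite !mulr_ge0 ?invr_ge0// ltW.
rewrite exprS; apply: ler_pM => //; first exact: ltW.
  by rewrite mulr_ge0 ?invr_ge0 ?ltW.
rewrite expr2; apply: ler_pM; rewrite ?invr_ge0 ?(ltW d0) ?(ltW d0')//.
  by rewrite -[leRHS]invrK lef_pV2 ?posrE.
by rewrite -[leRHS]invrK lef_pV2 ?posrE.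
Qed.

End Moebius.

Section QRatio.
Variables (R : realType) (L : R) (n : nat).
Hypothesis L1 : 1 <= L.
Implicit Types (q : R) (i j m : nat).

Let L0 : 0 < L. Proof. exact: lt_le_trans L1. Qed.

Definition pow_window q := 0 < q /\ forall k, (k <= n)%N -> L^-1 <= q ^+ k <= L.

(** The denominator of the Moebius map collapses to [1 + (q - 1) * qint m q = q ^+ m]; the rest is
    the reversal [q ^+ m * qint m q^-1 = q * qint m q]. *)
Lemma qratio_inv q m i : 0 < q -> (0 < m)%N -> (m <= i)%N ->
  qint m q^-1 / qint i q^-1 = moebius (q ^+ i) (qint m q / qint i q).
Proof.
move=> q0 m0 mi; have q0' : q != 0 by rewrite gt_eqF.
have i0 : (0 < i)%N by apply: leq_trans mi.
have qi0 : qint i q != 0 by rewrite gt_eqF ?qint_gt0// ltW.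
have qV0 : 0 <= q^-1 by rewrite invr_ge0 ltW.
have qiV0 : qint i q^-1 != 0 by rewrite gt_eqF ?qint_gt0.
have den : 1 - qint m q / qint i q + q ^+ i * (qint m q / qint i q) = q ^+ m.
  apply: (addIr (-1)); rewrite -qint_mulB.
  apply: (mulIf qi0).
  rewrite (_ : _ * qint i q = (q ^+ i - 1) * qint m q).
    by rewrite -qint_mulB; ring.
  by field.
have E k : (0 < k)%N -> q ^+ k * qint k q^-1 = q * qint k q.
  by case: k => // k _; rewrite exprS -mulrA qint_inv.
rewrite /moebius den.
apply: (mulIf qi0); apply: (mulIf qiV0); apply: (mulIf (expf_neq0 m q0')).
transitivity (q ^+ m * qint m q^-1 * qint i q); first by field.
transitivity (q ^+ i * qint i q^-1 * qint m q); last by field; rewrite qi0 expf_neq0.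
by rewrite !E//; ring.
Qed.

Lemma qratio_ge0_le1 q m i : 0 < q -> (0 < i)%N -> (m <= i)%N ->
  0 <= qint m q / qint i q <= 1.
Proof.
move=> q0 i0 mi; have q0' := ltW q0.
by rewrite divr_ge0 ?qint_ge0//= ler_pdivrMr ?qint_gt0// mul1r le_qint.
Qed.

(** Reconciles [geom_cdf i], which divides by [qint i], with [chain_martingale _ i], which divides
    by [qint i.+1]. *)
Lemma qratio_succ q m i : pow_window q -> (0 < i)%N -> (i < n)%N -> (m <= i)%N ->
  `|qint m q / qint i.+1 q - qint m q / qint i q| <= L ^+ 2 / i%:R.
Proof.
move=> [q0 qL] i0 i_n mi; have q0' := ltW q0.
have qi0 : 0 < qint i q by rewrite qint_gt0.
have qi1 : 0 < qint i.+1 q by rewrite qint_gt0.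
have -> : qint m q / qint i.+1 q - qint m q / qint i q =
   - (qint m q / qint i q * (q ^+ i / qint i.+1 q)).
  rewrite [qint i.+1 q in RHS]qintS.
  have e : q ^+ i = qint i.+1 q - qint i q by rewrite qintS addrC addKr.
  rewrite -qintS e; field; by rewrite !gt_eqF.
have /andP[r0 r1] := qratio_ge0_le1 q0 i0 mi.
have s0 : 0 <= q ^+ i / qint i.+1 q by rewrite divr_ge0 ?exprn_ge0 ?(ltW qi1).
rewrite normrN (ger0_norm (mulr_ge0 r0 s0)).
apply: (@le_trans _ _ (1 * (q ^+ i / qint i.+1 q))); first by rewrite ler_wpM2r.
rewrite mul1r ler_pdivrMr//.
have /andP[_ h] := qL i (ltnW i_n).
have /andP[h' _] := qint_bounds qL (leqW i_n).
have iR : 0 < i%:R :> R by rewrite ltr0n.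
apply: le_trans h _; apply: (@le_trans _ _ (L ^+ 2 / i%:R * (i%:R / L))).
  by rewrite le_eqVlt; apply/orP; left; apply/eqP; field; rewrite !gt_eqF.
rewrite ler_wpM2l ?divr_ge0 ?sqr_ge0 ?(ltW iR)//; apply: le_trans h'.
by rewrite ler_wpM2r ?invr_ge0 ?(ltW L0)// ler_nat.
Qed.

Lemma qratio_dist q q' m i e : pow_window q -> pow_window q' ->
  (forall k, (k <= n)%N -> `|q ^+ k - q' ^+ k| <= e) ->
  (0 < i)%N -> (i <= n.+1)%N -> (m <= i)%N ->
  `|qint m q / qint i q - qint m q' / qint i q'| <= 2 * L * e.
Proof.
move=> [q0 qL] [q0' qL'] qe i0 i_n mi.
have e0 : 0 <= e by apply: le_trans (qe 0%N isT).
have D k : (k <= n.+1)%N -> `|qint k q - qint k q'| <= k%:R * e.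
  move=> kn; rewrite /qint -sumrB; apply: le_trans (ler_norm_sum _ _ _) _.
  apply: (@le_trans _ _ (\sum_(j < k) e)).
    by apply: ler_sum => j _; apply: qe; rewrite -ltnS (leq_trans _ kn).
  by rewrite sumr_const card_ord -[leLHS]mulr_natl.
have qi0 : 0 < qint i q by rewrite qint_gt0// ltW.
have qi0' : 0 < qint i q' by rewrite qint_gt0// ltW.
have -> : qint m q / qint i q - qint m q' / qint i q' =
  ((qint m q - qint m q') + qint m q' / qint i q' * (qint i q' - qint i q)) / qint i q.
  by field; rewrite !gt_eqF.
have /andP[r0 r1] := qratio_ge0_le1 q0' i0 mi.
have iR : 0 < i%:R :> R by rewrite ltr0n.
rewrite normrM [X in _ * X]ger0_norm ?invr_ge0 ?(ltW qi0)// ler_pdivrMr//.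
apply: (@le_trans _ _ (2 * (i%:R * e))).
  apply: le_trans (ler_normD _ _) _; rewrite normrM (ger0_norm r0).
  have A := D m (leq_trans mi i_n); have B := D i i_n.
  have A' : m%:R * e <= i%:R * e by rewrite ler_wpM2r// ler_nat.
  have : qint m q' / qint i q' * `|qint i q' - qint i q| <= 1 * (i%:R * e).
    by rewrite ler_pM// distrC.
  lra.
have /andP[h' _] := qint_bounds qL i_n.
apply: (@le_trans _ _ (2 * L * e * (i%:R / L))).
  by rewrite le_eqVlt; apply/orP; left; apply/eqP; field; rewrite !gt_eqF.
by rewrite ler_wpM2l// !mulr_ge0// ltW.
Qed.

End QRatio.

(** The discrete counterpart, with [p = expR (- t / n)], is [expR (- t * m / n) = 1 + (expR (- t) -
    1) * (qint m p / qint n p)]. Comparing a path with the limit thus reduces to comparing a ratio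
    of [qint] with a Moebius value. *)
Lemma limit_path_moebius (R : realType) (x a t : R) : 0 <= a <= 1 -> t != 0 ->
  expR (- t * (1 - limit_path x a t)) =
  1 + (expR (- t) - 1) * moebius (expR (x * t)) (1 - a).
Proof.
move=> /andP[a0 a1] t0; rewrite /limit_path (negbTE t0).
set c := expR (x * t); have c0 : 0 < c by exact: expR_gt0.
have et := expR_gt0 t.
have den : 0 < c * (1 - a) + a.
  have [->|a0'] := eqVneq a 0; first by rewrite subr0 mulr1 addr0.
  by rewrite ltr_wpDl ?mulr_ge0 ?(ltW c0) ?subr_ge0// lt_neqAle eq_sym a0'.
have num : 0 < c * (1 - a) + a * expR t.
  have [->|a0'] := eqVneq a 0; first by rewrite subr0 mulr1 mul0r addr0.
  rewrite ltr_wpDl ?mulr_ge0 ?(ltW c0) ?subr_ge0// mulr_gt0//.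
  by rewrite lt_neqAle eq_sym a0'.
rewrite mulrBr mulr1 mulrA mulNr divff// mulN1r opprK expRD lnK; last first.
  by rewrite posrE divr_gt0.
have den' : 1 - (1 - a) + c * (1 - a) = c * (1 - a) + a by ring.
rewrite /moebius den' expRN; field.
by rewrite !gt_eqF.
Qed.

(** * Comparison of the concentrated quantities with the limit path *)

Section Transfer.
Variables (R : realType) (T alpha : R) (n : nat).
Hypotheses (T0 : 0 < T) (alpha0 : 0 < alpha) (n0 : (0 < n)%N).
(** Powers of [q t] up to [n + 1] occur, because [chain_martingale _ n] divides by [qint n.+1]; the
    factor 2 covers [(n + 1) / n <= 2]. *)
Let L := expR (2 * T).
Let q (t : R) := expR (t / n%:R).

Let nR : 0 < n%:R :> R. Proof. by rewrite ltr0n. Qed.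
Let L1 : 1 <= L.
Proof. by rewrite -[leLHS]expR0 ler_expR mulr_ge0// ltW. Qed.

Lemma expR_pow (t : R) k : q t ^+ k = expR (k%:R / n%:R * t).
Proof. by rewrite -expRM_natl; congr expR; ring. Qed.

Let frac k : (k <= n.+1)%N -> 0 <= (k%:R / n%:R : R) <= 2.
Proof.
move=> kn; rewrite divr_ge0//= ler_pdivrMr// -natrM ler_nat.
by apply: leq_trans kn _; rewrite mul2n -addnn -addn1 leq_add2l.
Qed.

Lemma window_q t : - T <= t <= T -> pow_window L n.+1 (q t).
Proof.
move=> /andP[t1 t2]; split; first exact: expR_gt0.
move=> k kn; rewrite expR_pow -expRN !ler_expR.
by have /andP[f0 f2] := frac kn; apply/andP; split; nra.
Qed.

Lemma dist_q t t' k : - T <= t <= T -> - T <= t' <= T -> (k <= n.+1)%N ->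
  `|q t ^+ k - q t' ^+ k| <= L * (2 * `|t - t'|).
Proof.
move=> /andP[t1 t2] /andP[s1 s2] kn; have /andP[f0 f2] := frac kn; rewrite !expR_pow.
apply: (le_trans (@expR_dist_le _ _ _ (2 * T) _ _)); [by nra | by nra |].
rewrite ler_wpM2l ?expR_ge0// -mulrBr normrM ger0_norm// ler_wpM2r//.
Qed.

Lemma q_opp t : (q t)^-1 = q (- t).
Proof. by rewrite /q mulNr expRN. Qed.

(* [rho0] and [rho] are the numbers of indices with larger images at times [0]
   and [t], and [l0], [l] the left inversions of the [i]-th index; the times
   [t1], [t2] at distance at most [h] from [t] are grid points. *)
Lemma transfer (t t1 t2 delta h : R) (i l l0 rho rho0 : nat) :
  - T <= t <= T -> - T <= t1 <= T -> - T <= t2 <= T ->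
  `|t - t1| <= h -> `|t - t2| <= h ->
  (i <= n)%N -> alpha * n%:R <= i%:R -> (l < i)%N -> (l0 < i)%N ->
  (rho < n)%N -> (rho0 < n)%N ->
  `|geom_cdf i l (q t1) - l0.+1%:R / i%:R| <= delta ->
  `|chain_martingale (q t2) n rho - chain_martingale (q t2) i l| <= delta ->
  `|rho0.+1%:R / n.+1%:R - l0.+1%:R / i.+1%:R| <= delta ->
  `|n%:R^-1 * (n - rho)%:R -
    limit_path (i%:R / n%:R) (n%:R^-1 * (n - rho0)%:R) t| <=
  (L ^+ 2 * (30 * L ^+ 5 * (1 + alpha^-1)) + 1) * (delta + h + n%:R^-1).
Proof.
move=> tT t1T t2T tt1 tt2 i_n ai li l0i rn r0n H1 H2 H3.
have h0 : 0 <= h by apply: le_trans tt1.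
have delta0 : 0 <= delta by apply: le_trans H1.
have ngt0 : 0 < n%:R^-1 :> R by rewrite invr_gt0.
have L0 : 0 < L by exact: expR_gt0.
have i0 : (0 < i)%N by apply: leq_ltn_trans li.
have iR : 0 < i%:R :> R by rewrite ltr0n.
have iV : i%:R^-1 <= alpha^-1 * n%:R^-1.
  by rewrite -invfM lef_pV2// posrE mulr_gt0.
set a := n%:R^-1 * (n - rho0)%:R; set x := i%:R / n%:R.
have aE : 1 - a = rho0%:R / n%:R.
  by rewrite /a (natrB _ (ltnW r0n)); field; rewrite gt_eqF.
have a01' : 0 <= 1 - a <= 1.
  by rewrite aE divr_ge0//= ler_pdivrMr// mul1r ler_nat ltnW.
have a01 : 0 <= a <= 1 by move: a01' => /andP[? ?]; apply/andP; split; lra.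
have W := window_q tT; have W1 := window_q t1T; have W2 := window_q t2T.
have oT s : - T <= s <= T -> - T <= - s <= T.
  by move=> /andP[? ?]; apply/andP; split; lra.
have V := window_q (oT _ tT); have V2 := window_q (oT _ t2T).
set e := 2 * L * (L * (2 * h)).
have De s s' : - T <= s <= T -> - T <= s' <= T -> `|s - s'| <= h ->
    forall k, (k <= n.+1)%N -> `|q s ^+ k - q s' ^+ k| <= L * (2 * h).
  move=> sT sT' ss' k kn; apply: le_trans (dist_q sT sT' kn) _.
  by rewrite ler_wpM2l ?(ltW L0)// ler_wpM2l.
pose w := qint l.+1 (q t) / qint i (q t).
have q0 s : 0 < q s by exact: expR_gt0.
have w01 : 0 <= w <= 1 by apply: qratio_ge0_le1.
have i_n1 : (i <= n.+2)%N by do 2 apply: leqW.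
have S2 : `|w - geom_cdf i l (q t1)| <= e.
  exact: (qratio_dist L1 W W1 (De _ _ tT t1T tt1)).
(* Time 0 serves as the link: there [q = 1], both martingales are linear, and the chain estimate
   replaces [l0.+1 / i.+1] by [rho0.+1 / n.+1]. The terms in [1 / n] pay for the shifts of numerator
   and denominators. *)
have S3 : `|w - (1 - a)| <= 2 * delta + e + (alpha^-1 + 1) * n%:R^-1.
  have A1 : `|l0.+1%:R / i%:R - l0.+1%:R / i.+1%:R| <= alpha^-1 * n%:R^-1 :> R.
    have -> : l0.+1%:R / i%:R - l0.+1%:R / i.+1%:R =
      l0.+1%:R / i.+1%:R * i%:R^-1 :> R.
      by rewrite -[i.+1%:R]natr1; field; rewrite gt_eqF//= natr1 pnatr_eq0.
    rewrite ger0_norm; last by rewrite mulr_ge0 ?invr_ge0// divr_ge0.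
    apply: le_trans iV; rewrite ler_piMl ?invr_ge0// ler_pdivrMr// mul1r ler_nat.
    exact: leqW.
  have nn1 : n%:R + 1 != 0 :> R by rewrite natr1 pnatr_eq0.
  have A2 : `|rho0.+1%:R / n.+1%:R - rho0%:R / n%:R| <= n%:R^-1 :> R.
    have -> : rho0.+1%:R / n.+1%:R - rho0%:R / n%:R =
      (1 - rho0%:R / n%:R) / n.+1%:R :> R.
      by rewrite -[rho0.+1%:R]natr1 -[n.+1%:R]natr1; field; rewrite nn1 gt_eqF.
    move: a01'; rewrite aE => /andP[b0 b1].
    rewrite ger0_norm; last by rewrite divr_ge0 ?subr_ge0.
    apply: (@le_trans _ _ (1 / n.+1%:R)).
      by rewrite ler_wpM2r ?invr_ge0// gerBl.
    by rewrite mul1r lef_pV2 ?posrE ?ltr0n// ler_nat.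
  rewrite aE; apply: le_trans (dist_trans S2 (dist_trans H1 (dist_trans A1
    (dist_trans (distr_le H3) A2)))) _.
  by rewrite le_eqVlt; apply/orP; left; apply/eqP; ring.
set eta3 := 2 * delta + e + _ in S3.
pose c := q t ^+ i.
have cL : L^-1 <= c <= L by apply: W.2; apply: leqW.
have S4 : `|qint l.+1 (q (- t)) / qint i (q (- t)) - moebius c (1 - a)| <= L ^+ 3 * eta3.
  rewrite -q_opp qratio_inv//.
  apply: le_trans (moebius_lipschitz L1 cL w01 a01') _.
  by rewrite ler_wpM2l// exprn_ge0// ltW.
have S5 : `|qint l.+1 (q (- t)) / qint i.+1 (q (- t)) -
    qint l.+1 (q (- t)) / qint i (q (- t))| <= L ^+ 2 * (alpha^-1 * n%:R^-1).
  apply: le_trans (qratio_succ L1 V i0 _ li) _; first by rewrite ltnS.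
  by rewrite ler_wpM2l// sqr_ge0.
have S5' : `|qint rho.+1 (q (- t)) / qint n.+1 (q (- t)) -
    qint rho.+1 (q (- t)) / qint n (q (- t))| <= L ^+ 2 * n%:R^-1.
  exact: (qratio_succ L1 V n0 (ltnSn n) rn).
have tt2' : `|- t2 - - t| <= h by rewrite opprK addrC.
have D2 := De _ _ (oT _ t2T) (oT _ tT) tt2'.
have S6 : `|chain_martingale (q t2) i l - qint l.+1 (q (- t)) / qint i.+1 (q (- t))| <= e.
  rewrite /chain_martingale q_opp; apply: (qratio_dist L1 V2 V D2) => //;
  exact: leqW.
have S7 : `|chain_martingale (q t2) n rho - qint rho.+1 (q (- t)) / qint n.+1 (q (- t))| <= e.
  by rewrite /chain_martingale q_opp; apply: (qratio_dist L1 V2 V D2) => //; apply: leqW.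
(* In units of [L ^+ 5 * (1 + alpha^-1)], the coefficients of [1 / n], [h] and [delta] found below
   are 2, 12 and 3; the constant 30 is generous. *)
set eta := 30 * L ^+ 5 * (1 + alpha^-1) * (delta + h + n%:R^-1).
have S8 : `|qint rho.+1 (q (- t)) / qint n (q (- t)) - moebius c (1 - a)| <= eta.
  apply: (@le_trans _ _ (L ^+ 2 * n%:R^-1 + e + delta + e +
      L ^+ 2 * (alpha^-1 * n%:R^-1) + L ^+ 3 * eta3)).
    apply: le_trans (dist_trans (distr_le S5') (dist_trans (distr_le S7)
      (dist_trans H2 (dist_trans S6 (dist_trans S5 S4))))) _.
    by rewrite le_eqVlt; apply/orP; left; apply/eqP; ring.
  set A := 1 + alpha^-1; set X := L ^+ 5 * A.
  have A1 : 1 <= A by rewrite lerDl invr_ge0 ltW.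
  have A0 : 0 <= A by apply: le_trans A1.
  have LX k : (k <= 5)%N -> L ^+ k * A <= X.
    by move=> k5; rewrite ler_wpM2r// ler_weXn2l.
  have LX' k : (k <= 5)%N -> L ^+ k <= X.
    by move=> k5; apply: le_trans (LX k k5); rewrite ler_peMr// exprn_ge0// ltW.
  have X0 : 0 <= X by apply: le_trans (LX' 0%N isT); rewrite expr0.
  rewrite /eta3 /e.
  have B1 := ler_wpM2r (ltW ngt0) (LX 2 isT).
  have B2 := ler_wpM2r (ltW ngt0) (LX 3 isT).
  have B3 := ler_wpM2r h0 (LX' 2 isT).
  have B4 := ler_wpM2r h0 (LX' 5 isT).
  have B5 := ler_wpM2r delta0 (LX' 0%N isT).
  have B6 := ler_wpM2r delta0 (LX' 3 isT).
  have X1 := mulr_ge0 X0 (ltW ngt0).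
  have X2 := mulr_ge0 X0 h0.
  have X3 := mulr_ge0 X0 delta0.
  rewrite [leLHS](_ : _ = L ^+ 2 * A * n%:R^-1 + L ^+ 3 * A * n%:R^-1 +
    8 * (L ^+ 2 * h) + 4 * (L ^+ 5 * h) + L ^+ 0 * delta + 2 * (L ^+ 3 * delta));
    last by rewrite /A expr0; ring.
  rewrite [leRHS](_ : _ = 30 * (X * n%:R^-1) + 30 * (X * h) + 30 * (X * delta));
    last by rewrite /eta /X /A; ring.
  apply: (@le_trans _ _ (X * n%:R^-1 + X * n%:R^-1 + 8 * (X * h) + 4 * (X * h) +
    X * delta + 2 * (X * delta))).
    by rewrite !lerD// ler_wpM2l.
  move: (X * n%:R^-1) (X * h) (X * delta) X1 X2 X3 => u v z u0 v0 z0; lra.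
have tz : `|rho.+1%:R / n%:R - (1 - limit_path x a t)| <= L ^+ 2 * eta.
  have eta0 : 0 <= eta by apply: le_trans S8.
  have [t0|t0] := eqVneq t 0.
    move: S8; rewrite /limit_path /c t0 eqxx oppr0 /q mul0r expR0 !qint1r expr1n.
    rewrite /moebius mul1r subrK divr1 => S8; apply: le_trans S8 _.
    by rewrite ler_peMl// exprn_ege1.
  set z := limit_path x a t; set r := qint _ _ / _ in S8.
  have E1 : expR (- t * (1 - z)) = 1 + (expR (- t) - 1) * moebius c (1 - a).
    by rewrite /c expR_pow; exact: limit_path_moebius.
  have E2 : expR (- t * (rho.+1%:R / n%:R)) = 1 + (expR (- t) - 1) * r.
    have qn0 : qint n (q (- t)) != 0 by rewrite gt_eqF// qint_gt0// ltW.
    have -> : expR (- t * (rho.+1%:R / n%:R)) = q (- t) ^+ rho.+1.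
      by rewrite expR_pow mulrC.
    have -> : expR (- t) = q (- t) ^+ n by rewrite expR_pow divff ?mul1r// gt_eqF.
    rewrite -[in RHS]qint_mulB /r -mulrA [qint n _ * _]mulrC divfK// qint_mulB.
    by rewrite addrC subrK.
  have /andP[t1' t2'] := tT.
  have Phi := moebius_ge0_le1 (expR_gt0 (i%:R / n%:R * t)) a01'.
  rewrite -expR_pow -/c in Phi; have /andP[Phi0 Phi1] := Phi.
  (* The exponential in [E1] is a convex combination of 1 and [expR (- t)], both at least
     [expR (- T)]. *)
  have B1 : - T <= - t * (1 - z).
    rewrite -ler_expR E1.
    have eT1 : expR (- T) <= 1 by rewrite -[leRHS]expR0 ler_expR oppr_le0 ltW.
    have eTt : expR (- T) <= expR (- t) by rewrite ler_expR lerN2.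
    have : expR (- T) * (1 - moebius c (1 - a)) <= 1 * (1 - moebius c (1 - a)).
      by rewrite ler_wpM2r// subr_ge0.
    have : expR (- T) * moebius c (1 - a) <= expR (- t) * moebius c (1 - a).
      by rewrite ler_wpM2r.
    by move: (moebius _ _) => M; lra.
  have B2 : - T <= - t * (rho.+1%:R / n%:R).
    have r0 : 0 <= rho.+1%:R / n%:R :> R by rewrite divr_ge0.
    have r1 : rho.+1%:R / n%:R <= 1 :> R by rewrite ler_pdivrMr// mul1r ler_nat.
    by nra.
  have := expR_dist_ge B2 B1; rewrite E1 E2.
  rewrite (_ : _ - (_ + _) = (expR (- t) - 1) * (r - moebius c (1 - a))); last by ring.
  rewrite -mulrBr normrM normrN [X in _ <= X -> _]normrM.
  set D := `|_ - (1 - z)| => H.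
  have tT' : - t <= T by lra.
  (* This bounds the factor [expR (- t) - 1] by a multiple of [|t|]; the same [|t|] multiplies [D]
     and cancels, so the estimate does not degenerate near [t = 0]. *)
  have := expR_dist_le tT' (ltW T0); rewrite expR0 subr0 normrN => Ht.
  have tp : 0 < `|t| by rewrite normr_gt0.
  have : expR (- T) * (`|t| * D) <= expR T * `|t| * eta.
    by apply: le_trans H _; apply: ler_pM.
  have eT := expR_gt0 T.
  rewrite expRN mulrC ler_pdivrMr// => H'.
  have {H'} : D <= expR T * expR T * eta.
    rewrite -(ler_pM2l tp); apply: le_trans H' _.
    by rewrite le_eqVlt; apply/orP; left; apply/eqP; ring.
  rewrite -expRD (_ : T + T = 2 * T); last by ring.
  rewrite -/L => H'; apply: le_trans H' _; rewrite ler_wpM2r// expr2 ler_peMl//.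
  exact: ltW.
have -> : n%:R^-1 * (n - rho)%:R - limit_path x a t =
  n%:R^-1 - (rho.+1%:R / n%:R - (1 - limit_path x a t)).
  by rewrite (natrB _ (ltnW rn)) -natr1; field; rewrite gt_eqF.
apply: le_trans (ler_normB _ _) _; rewrite (gtr0_norm ngt0) mulrDl mul1r addrC.
apply: lerD; first by apply: le_trans tz _; rewrite /eta mulrA.
by rewrite lerDr addr_ge0.
Qed.

End Transfer.

(** * Deviation probabilities *)

(* Optimizes [theta = lambda * n] in [time_chernoff] and [chain_law_chernoff]:
   the terms quadratic in [lambda] are at most half of [lambda * delta]. *)
Lemma deviation_exponent (R : realType) (alpha delta L x y : R) :
  let kappa := 1 + alpha^-1 in
  let lambda := Num.min (2 * L ^+ 2 * kappa)^-1 (delta / (4 * L ^+ 9 * kappa ^+ 2)) in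
  0 < alpha -> 0 < delta -> 1 <= L -> 0 < y -> alpha * x <= y -> 0 < x ->
  [/\ 0 < lambda, lambda * x * (L ^+ 2 / y) <= 2^-1,
      2 * lambda ^+ 2 * L ^+ 9 <= lambda * delta / 2 &
      2 * (lambda * x) ^+ 2 * (L ^+ 2 / y) ^+ 2 <= lambda * delta / 2].
Proof.
move=> kappa lambda a0 d0 L1 y0 xy x0.
have ai : 0 < alpha^-1 by rewrite invr_gt0.
have L0 : 0 < L by lra.
have k1 : 1 <= kappa by rewrite /kappa; lra.
have ka : alpha^-1 <= kappa by rewrite /kappa; lra.
have k0 : 0 < kappa by lra.
have D1 : 0 < 2 * L ^+ 2 * kappa by rewrite !mulr_gt0// exprn_gt0.
have D2 : 0 < 4 * L ^+ 9 * kappa ^+ 2.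
  by apply: mulr_gt0; [apply: mulr_gt0 => //; exact: exprn_gt0 | exact: exprn_gt0].
have l0 : 0 < lambda by rewrite lt_min invr_gt0 D1 divr_gt0.
have l1 : lambda * (2 * L ^+ 2 * kappa) <= 1.
  by rewrite -ler_pdivlMr// div1r ge_min lexx.
have l2 : lambda * (4 * L ^+ 9 * kappa ^+ 2) <= delta.
  by rewrite -ler_pdivlMr// ge_min lexx orbT.
have xy' : x * (L ^+ 2 / y) <= L ^+ 2 * kappa.
  rewrite mulrCA ler_wpM2l ?exprn_ge0 ?(ltW L0)//.
  rewrite ler_pdivrMr//; apply: (@le_trans _ _ (alpha^-1 * y)).
    by rewrite -ler_pdivrMl ?invr_gt0// invrK.
  by rewrite ler_wpM2r// ltW.
have q0 : 0 <= x * (L ^+ 2 / y).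
  by apply: mulr_ge0; [exact: ltW | apply: divr_ge0; [exact/exprn_ge0/ltW | exact: ltW]].
have B u : u <= L ^+ 9 * kappa ^+ 2 -> 2 * lambda ^+ 2 * u <= lambda * delta / 2.
  move=> uM; have H1 := ler_wpM2l (ltW l0) uM.
  have H2 : lambda * u * 4 <= delta by lra.
  have := ler_wpM2l (ltW l0) H2; rewrite expr2; lra.
have k2 : 1 <= kappa ^+ 2 by rewrite exprn_ege1.
split=> //.
- rewrite -mulrA; have := ler_wpM2l (ltW l0) xy'; lra.
- by apply: B; rewrite ler_peMr// exprn_ge0// ltW.
- rewrite (_ : 2 * _ * _ = 2 * lambda ^+ 2 * (x * (L ^+ 2 / y)) ^+ 2); last by ring.
  apply: B; apply: (@le_trans _ _ ((L ^+ 2 * kappa) ^+ 2)).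
    rewrite lerXn2r// nnegrE//; apply: mulr_ge0; [exact/exprn_ge0/ltW | exact: ltW].
  rewrite exprMn -exprM ler_wpM2r//; first exact: le_trans k2.
  by rewrite ler_weXn2l.
Qed.

Section Deviation.
Context (R : realType) (d : measure_display) (Omega : measurableType d).
Variables (P : probability Omega R) (n : nat).
Variables (l : 'I_n -> R -> Omega -> nat) (sigma : R -> Omega -> 'S_n).
Hypothesis Hsigma : birth_mallows_process P l sigma.
Hypothesis n0 : (0 < n)%N.
Variables (T alpha delta : R).
Hypotheses (T0 : 0 < T) (alpha0 : 0 < alpha) (delta0 : 0 < delta).
Let L := expR (2 * T).
Let q (t : R) := expR (t / n%:R).
Let kappa := 1 + alpha^-1.
Let lambda := Num.min (2 * L ^+ 2 * kappa)^-1 (delta / (4 * L ^+ 9 * kappa ^+ 2)).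

(** The prefactor stems from the drift in [time_chernoff]; half of the gain [lambda * delta * n] is
    spent on the quadratic terms. *)
Definition deviation_bound : R := expR (lambda * L ^+ 8) * expR (- (lambda * delta / 2) * n%:R).

Let nR : 0 < n%:R :> R. Proof. by rewrite ltr0n. Qed.
Let L1 : 1 <= L.
Proof. by rewrite -[leLHS]expR0 ler_expR mulr_ge0// ltW. Qed.
Let L0 : 0 < L. Proof. exact: expR_gt0. Qed.

Let mY i t k : 0 <= t -> measurable [set w | l i t w = k].
Proof. exact: (measurable_birth_level (mallows_birth Hsigma i)). Qed.

Lemma sigma_of_event (i : 'I_n) (c : pred nat) (t : R) : 0 <= t ->
  sigma_of (l i) `[0, +oo[ [set w | c (l i t w)].
Proof.
move=> t0; have [h0 hC hU] := smallest_sigma_algebra setT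
  [set [set w | l i u w = k] | u in `[(0 : R), +oo[ & k in [set: nat]].
have -> : [set w | c (l i t w)] =
    \bigcup_k (if c k then [set w | l i t w = k] else set0).
  apply/seteqP; split => w /=; first by move=> cw; exists (l i t w) => //; rewrite cw.
  by move=> [k _]; case: ifP => // ck /= ->.
apply: hU => k; case: ifP => _ //.
apply: sub_sigma_algebra; exists t; first by rewrite /= in_itv /= t0.
by exists k.
Qed.

Lemma independent_events (t : R) (b : 'I_n -> nat -> bool) : 0 <= t ->
  pr P [set w | forall i, b i (l i t w)] = \prod_(i < n) pr P [set w | b i (l i t w)].
Proof.
move=> t0; rewrite /pr.
have -> : [set w | forall i, b i (l i t w)] =
    \bigcap_(i in [set: 'I_n]) [set w | b i (l i t w)].
  by apply/seteqP; split => w /= H i; [move=> _; exact: H | exact: H].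
rewrite (mallows_independent Hsigma (A := fun i => [set w | b i (l i t w)])).
  rewrite (eq_bigr (fun i => (pr P [set w | b i (l i t w)])%:E)) ?prodEFin//.
  move=> i _; apply: prK.
  exact: (@measurable_nat_family _ _ unit (fun=> l i t) (fun v => b i (v tt))
    (fun _ k => mY i k t0)).
by move=> i; exact: sigma_of_event.
Qed.

Definition bad_chain t (i : 'I_n) (r : nat) : set Omega := [set w | delta <
  `|chain_martingale (q t) n (chain (ord_fun (fun j => l j (q t) w)) i.+1 r (n - i.+1))
    - chain_martingale (q t) i.+1 r|].

Definition bad_time t (i : 'I_n) : set Omega := [set w | delta <
  `|geom_cdf i.+1 (l i (q t) w) (q t) - (l i 1 w).+1%:R / i.+1%:R|].

Lemma measurable_bad_chain t i r : measurable (bad_chain t i r).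
Proof.
exact: (@measurable_nat_family _ _ 'I_n (fun j => l j (q t)) (fun v => delta <
  `|chain_martingale (q t) n (chain (ord_fun v) i.+1 r (n - i.+1))
    - chain_martingale (q t) i.+1 r|) (fun j k => mY j k (expR_ge0 _))).
Qed.

Lemma measurable_bad_time t i : measurable (bad_time t i).
Proof.
apply: (@measurable_nat_family _ _ bool (fun b => l i (if b then q t else 1))
  (fun v => delta < `|geom_cdf i.+1 (v true) (q t) - (v false).+1%:R / i.+1%:R|)).
by case => k; apply: mY => //; exact: expR_ge0.
Qed.

Lemma pr_abs_gt (X : Omega -> R) (x : R) :
  measurable [set w | x < `|X w|] ->
  measurable [set w | x <= X w] -> measurable [set w | x <= - X w] ->
  pr P [set w | x < `|X w|] <= pr P [set w | x <= X w] + pr P [set w | x <= - X w].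
Proof.
move=> m0 m1 m2.
have mD : measurable ([set w | x <= - X w] `\` [set w | x <= X w]) by exact: measurableD.
apply: (@le_trans _ _ (pr P ([set w | x <= X w] `|`
    ([set w | x <= - X w] `\` [set w | x <= X w])))).
  apply: le_pr => //; first exact: measurableU.
  move=> w /= H; have [h|h] := EM (x <= X w); [by left | right; split => //=].
  by move: H h => /[swap] /negP; rewrite -ltNge; case: (ler0P (X w)); lra.
rewrite prU//; last by apply/seteqP; split => w // [] h [].
by rewrite lerD2l le_pr//; move=> w [].
Qed.

Lemma pr_bad_chain t (i : 'I_n) r : - T <= t <= T -> alpha * n%:R <= i.+1%:R ->
  (r < i.+1)%N -> pr P (bad_chain t i r) <= 2 * deviation_bound.
Proof.
move=> tT ai ri.
have [_ W] := window_q n0 tT; rewrite -/L -/(q t) in W.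
have iR : 0 < i.+1%:R :> R by [].
have [l0 h1 h2 h3] := deviation_exponent alpha0 delta0 L1 iR ai nR.
rewrite -/kappa -/lambda in l0 h1 h2 h3.
pose X w : R := chain_martingale (q t) n
  (chain (ord_fun (fun j => l j (q t) w)) i.+1 r (n - i.+1)) -
  chain_martingale (q t) i.+1 r.
have W' k : (k <= n)%N -> L^-1 <= (q t)^-1 ^+ k <= L.
  have tT' : - T <= - t <= T by move: tT => /andP[? ?]; apply/andP; split; lra.
  have [_ V] := window_q n0 tT'; move=> kn.
  by rewrite /q -expRN -mulNr; apply: V; exact: leqW.
have key s : `|s| = lambda * n%:R ->
    pr P [set w | lambda * n%:R * delta <= s * X w] <= deviation_bound.
  move=> sE; have th : `|s| * (L ^+ 2 / i.+1%:R) <= 2^-1 by rewrite sE.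
  have kmn : (i.+1 + (n - i.+1) = n)%N by rewrite subnKC.
  have HF (j : 'I_n) k : (k <= j)%N -> pr P [set w | (l j (q t) w <= k)%N] =
      geom_cdf j.+1 k (q t).
    move=> kj; apply: (birth_marginal _ (mallows_birth Hsigma j)) => //.
    exact: expR_ge0.
  (* The threshold contains the deterministic initial value of the martingale, which cancels in the
     exponent of [chain_law_chernoff]. *)
  pose x := lambda * n%:R * delta + s * chain_martingale (q t) i.+1 r.
  have H := chain_law_chernoff (expR_gt0 _) (ltn0Sn i) W' th x (leqnn _) kmn ri.
  rewrite -(@pr_chain _ _ _ P n (fun j => l j (q t)) (fun j k => mY j k (expR_ge0 _))
    (fun b => independent_events b (expR_ge0 _))
    (fun k r => geom_cdf k.+1 r (q t))
    (fun r => x <= s * chain_martingale (q t) n r) _ _ _ kmn HF ri) in H.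
  rewrite (_ : [set w | _] = [set w | lambda * n%:R * delta +
    s * chain_martingale (q t) i.+1 r <= s * chain_martingale (q t) n
      (chain (ord_fun (fun j => l j (q t) w)) i.+1 r (n - i.+1))]); last first.
    by apply/seteqP; split => w /=; rewrite /X mulrBr lerBrDr.
  apply: le_trans H _; rewrite /x; rewrite /deviation_bound -expRD ler_expR.
  have s2 : s ^+ 2 = (lambda * n%:R) ^+ 2 by rewrite -sE real_normK ?num_real.
  rewrite s2 (_ : _ - _ = - (lambda * n%:R * delta)); last by ring.
  have : (n - i.+1)%:R * (2 * (lambda * n%:R) ^+ 2 * (L ^+ 2 / i.+1%:R) ^+ 2) <=
      n%:R * (lambda * delta / 2).
    apply: ler_pM => //; last by rewrite ler_nat leq_subr.
    by apply: mulr_ge0; [apply: mulr_ge0 => //; exact: sqr_ge0 | exact: sqr_ge0].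
  move=> H'; rewrite (_ : _ + - _ * _ =
    lambda * L ^+ 8 + (- (lambda * n%:R * delta) + n%:R * (lambda * delta / 2)));
    last by field.
  rewrite -[leLHS]add0r lerD ?lerD2l// mulr_ge0 ?(ltW l0)// exprn_ge0// ltW//.
have mX (D : R -> Prop) : measurable [set w | D (X w)].
  exact: (@measurable_nat_family _ _ 'I_n (fun j => l j (q t)) (fun v => D (
    chain_martingale (q t) n (chain (ord_fun v) i.+1 r (n - i.+1))
    - chain_martingale (q t) i.+1 r)) (fun j k => mY j k (expR_ge0 _))).
have ln0 : 0 < lambda * n%:R by rewrite mulr_gt0.
apply: le_trans (pr_abs_gt _ _ _) _.
- exact: (mX (fun x => delta < `|x|)).
- exact: (mX (fun x => delta <= x)).
- exact: (mX (fun x => delta <= - x)).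
rewrite (_ : 2 * _ = deviation_bound + deviation_bound); last by ring.
apply: lerD.
  have := key (lambda * n%:R) (gtr0_norm ln0); congr (pr P _ <= _).
  by apply/seteqP; split => w /=; rewrite ler_pM2l.
have := key (- (lambda * n%:R)); rewrite normrN => /(_ (gtr0_norm ln0)).
congr (pr P _ <= _).
by apply/seteqP; split => w /=; rewrite mulNr -mulrN ler_pM2l.
Qed.

Lemma pr_bad_time t (i : 'I_n) : - T <= t <= T -> alpha * n%:R <= i.+1%:R ->
  pr P (bad_time t i) <= 2 * deviation_bound.
Proof.
move=> tT ai.
have iR : 0 < i.+1%:R :> R by [].
have [l0 h1 h2 h3] := deviation_exponent alpha0 delta0 L1 iR ai nR.
rewrite -/kappa -/lambda in l0 h1 h2 h3.
have q1 : q 0 = 1 by rewrite /q mul0r expR0.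
pose X w : R := geom_cdf i.+1 (l i (q t) w) (q t) - geom_cdf i.+1 (l i (q 0) w) (q 0).
have XE w : X w = geom_cdf i.+1 (l i (q t) w) (q t) - (l i 1 w).+1%:R / i.+1%:R.
  by rewrite /X q1 /geom_cdf !qint1r.
have -> : bad_time t i = [set w | delta < `|X w|].
  by apply/seteqP; split => w; rewrite /bad_time /= XE.
have tl : T <= expR T by apply: le_trans (expR_ge1Dx _); rewrite lerDr.
have LE : expR T * expR T = L by rewrite -expRD; congr expR; ring.
have key (a b s : R) : - T <= a -> a <= b -> b <= T -> `|a - b| <= T ->
    `|s| = lambda * n%:R ->
    pr P [set w | lambda * n%:R * delta <= s * (geom_cdf i.+1 (l i (q b) w) (q b) -
      geom_cdf i.+1 (l i (q a) w) (q a))] <= deviation_bound.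
  move=> Ta ab bT abT sE.
  have th : `|s| * (L ^+ 2 / i.+1%:R) <= 2^-1 by rewrite sE.
  have qab : q a <= q b by rewrite ler_expR ler_wpM2r// invr_ge0 ltW.
  have inv v : q a <= v -> v <= q b -> exists2 u, - T <= u <= T & v = q u.
    move=> av vb; have v0 : 0 < v by apply: lt_le_trans av; exact: expR_gt0.
    have vE : v = q (n%:R * ln v).
      by rewrite /q mulrAC divff ?gt_eqF// mul1r lnK.
    exists (n%:R * ln v) => //.
    have av' : q a <= q (n%:R * ln v) by rewrite -vE.
    have vb' : q (n%:R * ln v) <= q b by rewrite -vE.
    move: av' vb'; rewrite !ler_expR !ler_pM2r ?invr_gt0// => av' vb'.
    by rewrite (le_trans Ta av') (le_trans vb' bT).
  have powL v : q a <= v -> v <= q b -> forall k, (k <= i.+1)%N -> L^-1 <= v ^+ k <= L.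
    move=> av vb k ki; have [u uT ->] := inv v av vb.
    have [_ V] := window_q n0 uT.
    by apply: V; apply: leq_trans ki _; apply: leqW.
  (* The exponential has slope at most [expR T] here, and [T <= expR T] turns [expR T * T] into
     [L]. *)
  have dist u u' : - T <= u <= T -> - T <= u' <= T -> `|u - u'| <= T ->
      n%:R * `|q u - q u'| <= L.
    move=> /andP[u1 u2] /andP[v1 v2] uu.
    have un z : z <= T -> z / n%:R <= T.
      move=> zT; have [z0|z0] := leP 0 z.
        by apply: le_trans zT; rewrite ler_piMr// invf_le1// ler1n.
      by apply: le_trans (ltW T0); rewrite mulr_le0_ge0 ?invr_ge0 ?ltW.
    have H := expR_dist_le (un _ u2) (un _ v2).
    apply: (@le_trans _ _ (n%:R * (expR T * `|u / n%:R - u' / n%:R|))).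
      by rewrite ler_wpM2l// ltW.
    rewrite -mulrBl normrM [X in _ * (_ * (_ * X))]gtr0_norm ?invr_gt0//.
    rewrite (_ : _ * _ = expR T * `|u - u'|); last by field; rewrite gt_eqF.
    by rewrite -LE ler_wpM2l ?expR_ge0// (le_trans uu).
  have T00 : - T <= (0 : R) <= T by rewrite oppr_le0 (ltW T0).
  have oneL v : q a <= v -> v <= q b -> i.+1%:R * `|v - 1| <= L.
    move=> av vb; have [u uT ->] := inv v av vb.
    have -> : q u - 1 = q u - q 0 by rewrite q1.
    have u0T : `|u - 0| <= T by rewrite subr0 ler_norml.
    apply: le_trans (dist _ _ uT T00 u0T).
    by apply: ler_wpM2r => //; rewrite ler_nat; exact: ltn_ord.
  have H := time_chernoff (ltn0Sn i) (mallows_birth Hsigma i) (expR_gt0 _) qab powL oneL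
    th (lambda * n%:R * delta).
  apply: le_trans H _; rewrite /deviation_bound -expRD ler_expR.
  have s2 : s ^+ 2 = (lambda * n%:R) ^+ 2 by rewrite -sE real_normK ?num_real.
  have aT : - T <= a <= T by rewrite Ta (le_trans ab).
  have bT' : - T <= b <= T by rewrite bT (le_trans Ta).
  have D := dist _ _ aT bT' abT; rewrite distrC ger0_norm ?subr_ge0// in D.
  have D' : q b - q a <= L / n%:R by rewrite ler_pdivlMr// mulrC.
  rewrite sE s2; set c := lambda * n%:R * L ^+ 7 + _.
  have c0 : 0 <= c.
    have ln0 : 0 <= lambda * n%:R by rewrite mulr_ge0// ltW.
    have Lk k : 0 <= L ^+ k by rewrite exprn_ge0// ltW.
    have sq0 : 0 <= 2 * (lambda * n%:R) ^+ 2 by rewrite mulr_ge0// sqr_ge0.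
    by rewrite addr_ge0 ?(mulr_ge0 ln0)// (mulr_ge0 sq0).
  have cD := ler_wpM2l c0 D'.
  have cE : c * (L / n%:R) = lambda * L ^+ 8 + 2 * lambda ^+ 2 * L ^+ 9 * n%:R.
    by rewrite /c; field; rewrite gt_eqF.
  rewrite cE in cD; apply: le_trans (lerB cD (lexx _)) _.
  have h2n := ler_wpM2r (ltW nR) h2.
  rewrite (_ : lambda * n%:R * delta = lambda * delta / 2 * n%:R +
    lambda * delta / 2 * n%:R); last by field.
  by rewrite mulNr -addrA lerD2l opprD addrA -[leRHS]add0r lerD2r subr_le0.
have mX (D : R -> Prop) : measurable [set w | D (X w)].
  apply: (@measurable_nat_family _ _ bool (fun b => l i (if b then q t else q 0))
    (fun v => D (geom_cdf i.+1 (v true) (q t) - geom_cdf i.+1 (v false) (q 0)))).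
  by case => k; apply: mY => //; exact: expR_ge0.
have ln0 : 0 < lambda * n%:R by rewrite mulr_gt0.
apply: le_trans (pr_abs_gt _ _ _) _.
- exact: (mX (fun x => delta < `|x|)).
- exact: (mX (fun x => delta <= x)).
- exact: (mX (fun x => delta <= - x)).
rewrite (_ : 2 * _ = deviation_bound + deviation_bound); last by ring.
move: tT => /andP[t1 t2].
(* The process runs forward only: for [t <= 0] the interval is [[q t, 1]], the endpoints change
   roles, and [s] changes sign. *)
have keyX s : `|s| = lambda * n%:R ->
    pr P [set w | lambda * n%:R * delta <= s * X w] <= deviation_bound.
  move=> sE; have [t0|/ltW t0] := leP 0 t.
    apply: key => //; first by rewrite oppr_le0 ltW.
    by rewrite sub0r normrN ger0_norm.
  have := key t 0 (- s) t1 t0 (ltW T0); rewrite subr0 ler0_norm// normrN.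
  move=> /(_ _ sE); have tT : - t <= T by lra.
  move=> /(_ tT); congr (pr P _ <= _).
  by apply/seteqP; split => w /=; rewrite mulNr -mulrN opprB.
apply: lerD.
  have := keyX (lambda * n%:R) (gtr0_norm ln0); congr (pr P _ <= _).
  by apply/seteqP; split => w /=; rewrite ler_pM2l.
have := keyX (- (lambda * n%:R)); rewrite normrN => /(_ (gtr0_norm ln0)).
congr (pr P _ <= _).
by apply/seteqP; split => w /=; rewrite mulNr -mulrN ler_pM2l.
Qed.

End Deviation.

(** * Sandwiching a path between grid times *)

Lemma leq_ord_fun n (l l' : 'I_n -> nat) k : (forall j, (l j <= l' j)%N) ->
  (ord_fun l k <= ord_fun l' k)%N.
Proof. by move=> H; rewrite /ord_fun; case: insub => /=. Qed.

Lemma addn_subr a b c : (a + b = c)%N -> b = (c - a)%N.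
Proof. lia. Qed.

Lemma addn_lt a b c : (a + b.+1 = c)%N -> (a < c)%N.
Proof. lia. Qed.

Lemma natr_dist_lt1 (R : realDomainType) (a b : nat) : `|a%:R - b%:R| < 1 :> R -> a = b.
Proof.
rewrite ltr_norml => /andP[A B].
have : (a < b.+1)%N by rewrite -(ltr_nat R) -natr1; lra.
have : (b < a.+1)%N by rewrite -(ltr_nat R) -natr1; lra.
lia.
Qed.

Section Sandwich.
Context (R : realType) (d : measure_display) (Omega : measurableType d).
Variables (P : probability Omega R) (n : nat).
Variables (l : 'I_n -> R -> Omega -> nat) (sigma : R -> Omega -> 'S_n).
Hypothesis Hsigma : birth_mallows_process P l sigma.
Hypothesis n0 : (0 < n)%N.
Variables (T alpha delta : R).
Hypotheses (T0 : 0 < T) (alpha0 : 0 < alpha) (delta0 : 0 < delta).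

Let q (t : R) := expR (t / n%:R).

Definition above (i : 'I_n) (tau : R) (w : Omega) : nat :=
  chain (ord_fun (fun j => l j tau w)) i.+1 (l i tau w) (n - i.+1).

Lemma aboveE i tau w : 0 <= tau -> (above i tau w + (sigma tau w i).+1 = n)%N.
Proof.
move=> tau0; have := perm_chain (sigma tau w) i.
rewrite (_ : left_inversions (sigma tau w) = fun j => l j tau w); last first.
  by apply/funext => j; exact: (mallows_left_inversions Hsigma).
by move=> E; rewrite /above E subnK.
Qed.

Lemma rescaled_pathE i t w :
  rescaled_path sigma i t w = n%:R^-1 * (n - above i (q t) w)%:R.
Proof.
rewrite /rescaled_path -/(q t); congr (_ * _%:R).
by apply: addn_subr; exact: (aboveE i w (expR_ge0 (t / n%:R))).
Qed.

Lemma above_lt i tau w : 0 <= tau -> (above i tau w < n)%N.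
Proof. by move=> tau0; apply: addn_lt; exact: (aboveE i w tau0). Qed.

Definition transfer_constant : R :=
  expR (2 * T) ^+ 2 * (30 * expR (2 * T) ^+ 5 * (1 + alpha^-1)) + 1.

Lemma sandwich (i : 'I_n) w (t t1 t2 h : R) : - T <= t1 -> t1 <= t -> t <= t2 -> t2 <= T ->
  t - t1 <= h -> t2 - t <= h -> alpha * n%:R <= i.+1%:R ->
  (forall s, s = t1 \/ s = t2 -> ~ bad_time l delta s i w) ->
  (forall s r, [\/ s = t1, s = t2 | s = 0] -> (r < i.+1)%N ->
    ~ bad_chain l delta s i r w) ->
  `|rescaled_path sigma i t w -
    limit_path (i.+1%:R / n%:R) (rescaled_path sigma i 0 w) t| <=
  transfer_constant * (delta + h + n%:R^-1).
Proof.
move=> Tt1 t1t tt2 t2T h1 h2 ai badt badc.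
have qt s : 0 <= q s by exact: expR_ge0.
have q01 : q 0 = 1 by rewrite /q mul0r expR0.
have li s : (l i (q s) w < i.+1)%N.
  exact: birth_range (mallows_birth Hsigma i) _ _ (qt s).
have mono s s' j : s <= s' -> (l j (q s) w <= l j (q s') w)%N.
  move=> ss; apply: (birth_monotone (mallows_birth Hsigma j)) => //.
  by rewrite ler_expR ler_wpM2r// invr_ge0.
(* Two times are mixed: the start is taken at [s'], the later left inversions at [s]. As these act
   in opposite directions, the lower bound pairs the early start with the late inversions, and the
   upper bound conversely. *)
pose path s s' := chain (ord_fun (fun j => l j (q s) w)) i.+1 (l i (q s') w) (n - i.+1).
have pathn s s' : (path s s' < n)%N.
  by have := chain_bound (ord_fun (fun j => l j (q s) w)) (n - i.+1) (li s'); rewrite subnKC.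
have lo : (path t2 t1 <= above i (q t) w)%N.
  by apply: leq_chain => [|j]; [exact: mono | apply: leq_ord_fun => k; exact: mono].
have hi : (above i (q t) w <= path t1 t2)%N.
  by apply: leq_chain => [|j]; [exact: mono | apply: leq_ord_fun => k; exact: mono].
(* At time 0 the chain martingale is [(r + 1) / (k + 1)]; its concentration ties the anchor of the
   limit path to the left inversions of [i]. *)
have H3 : `|(above i (q 0) w).+1%:R / n.+1%:R -
    (l i (q 0) w).+1%:R / i.+2%:R| <= delta.
  have /negP := badc 0 (l i (q 0) w) (Or33 _ _ erefl) (li 0).
  rewrite -leNgt /chain_martingale -/(q 0) q01 invr1 !qint1r /above.
  exact.
have tr s s' : [\/ s = t1 | s = t2] -> [\/ s' = t1 | s' = t2] ->
    `|n%:R^-1 * (n - path s s')%:R - limit_path (i.+1%:R / n%:R)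
      (n%:R^-1 * (n - above i (q 0) w)%:R) t| <=
    transfer_constant * (delta + h + n%:R^-1).
  move=> ss ss'.
  have win v : [\/ v = t1 | v = t2] -> - T <= v <= T /\ `|t - v| <= h.
    case=> ->; (split; first by apply/andP; split; lra).
      by rewrite ger0_norm; lra.
    by rewrite ler0_norm; lra.
  have [sT sh] := win _ ss; have [sT' sh'] := win _ ss'.
  apply: (transfer T0 alpha0 n0 _ sT' sT sh' sh (ltn_ord i) ai (li s') (li 0)
    (pathn s s') (above_lt i w (qt 0)) _ _ H3).
  - by apply/andP; split; lra.
  - have := badt s' ss' => /negP; rewrite -leNgt -/(q s') {1}q01 //.
  - have := badc s (l i (q s') w); move/(_ _ (li s')) => H.
    have /H/negP : [\/ s = t1, s = t2 | s = 0].
      by case: ss => ->; [apply: Or31 | apply: Or32].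
    by rewrite -leNgt.
have := tr _ _ (or_introl erefl) (or_intror erefl).
have := tr _ _ (or_intror erefl) (or_introl erefl).
rewrite !rescaled_pathE !ler_norml.
have ni : 0 <= n%:R^-1 :> R by rewrite invr_ge0.
have A : n%:R^-1 * (n - above i (q t) w)%:R <= n%:R^-1 * (n - path t2 t1)%:R :> R.
  by rewrite ler_wpM2l// ler_nat leq_sub2l.
have B : n%:R^-1 * (n - path t1 t2)%:R <= n%:R^-1 * (n - above i (q t) w)%:R :> R.
  by rewrite ler_wpM2l// ler_nat leq_sub2l.
move=> /andP[_ C] /andP[D _]; apply/andP; split.
  by apply: le_trans D _; rewrite lerD2r.
by apply: le_trans C; rewrite lerD2r.
Qed.

Lemma inversions_right_constant w tau (j : 'I_n) : 0 <= tau ->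
  exists2 eta, 0 < eta &
  forall tau', tau <= tau' -> tau' < tau + eta -> l j tau' w = l j tau w.
Proof.
move=> tau0; have [/(_ tau tau0) + _] := birth_cadlag (mallows_birth Hsigma j) w.
move=> /cvgr_dist_lt /(_ 1 ltr01) [x /= x0 Hx]; exists x => // tau'.
rewrite le_eqVlt => /orP[/eqP<-//|tt] tx.
have := Hx tau'; rewrite /ball_/= distrC ger0_norm ?subr_ge0 ?(ltW tt)//.
rewrite ltrBlDl => /(_ tx tt).
by move=> /natr_dist_lt1 ->.
Qed.

(** Right-continuous integer-valued functions are constant on a right neighbourhood, and [above]
    recovers the permutation from them. This serves the measurability of the error event, in which
    uncountably many times occur. *)
Lemma path_right_constant w tau : 0 <= tau -> exists2 eta, 0 < eta &
  forall tau', tau <= tau' -> tau' < tau + eta -> forall i, sigma tau' w i = sigma tau w i.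
Proof.
move=> tau0.
have [j|eta eta0 H] := @uniform_delta R n
  (fun j x => forall j' : 'I_n, j' = j :> nat -> forall tau', tau <= tau' ->
    tau' < tau + x -> l j' tau' w = l j' tau w)
  (fun j x y yx H j' jj tau' t1 t2 => H j' jj tau' t1 (lt_le_trans t2 (lerD (lexx _) yx))).
  have [jn|nj] := ltnP j n; last first.
    by exists 1 => // j' jj; move: (ltn_ord j'); rewrite jj ltnNge nj.
  have [x x0 Hx] := inversions_right_constant w (Ordinal jn) tau0.
  by exists x => // j' jj; have -> : j' = Ordinal jn by apply: val_inj.
exists eta => // tau' t1 t2 i; apply: val_inj.
have tau0' : 0 <= tau' by lra.
have E : (fun j => l j tau' w) = (fun j => l j tau w).
  by apply/funext => j; exact: (H j (ltn_ord j)).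
have A : above i tau' w = above i tau w.
  by rewrite /above E (H i (ltn_ord i) i erefl _ t1 t2).
have := etrans (aboveE i w tau0') (esym (aboveE i w tau0)).
by rewrite A => /addnI [].
Qed.

End Sandwich.

(** * The error event and its measurability *)

Lemma lt_bigmax_ereal_sup (R : realType) (I : finType) (c : pred I) (U : Type)
    (D : set U) (F : I -> U -> R) (eps : R) : 0 < eps ->
  (eps%:E < \big[maxe/0%E]_(i | c i) ereal_sup [set (F i t)%:E | t in D])%E <->
  exists2 i, c i & exists2 t, D t & eps < F i t.
Proof.
move=> e0; split.
  (* Positivity of [eps] excludes the default value 0 of the maximum. *)
  move=> /bigmax_gtP[|[i ci /ereal_sup_gt[_ [t Dt <-]]]]; first by rewrite lte_fin ltNge ltW.
  by rewrite lte_fin => h; exists i => //; exists t.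
move=> [i ci [t Dt h]]; apply/bigmax_gtP; right; exists i => //.
by apply: (@lt_le_trans _ _ (F i t)%:E); [rewrite lte_fin | apply: ereal_sup_ubound; exists t].
Qed.

Lemma limit_path_continuous (R : realType) (x a t : R) : 0 <= a <= 1 -> t != 0 ->
  {for t, continuous (limit_path x a)}.
Proof.
move=> /andP[a0 a1] t0.
have c0 : 0 < expR (x * t) by exact: expR_gt0.
have et := expR_gt0 t.
have den : 0 < expR (x * t) * (1 - a) + a.
  have [->|a0'] := eqVneq a 0; first by rewrite subr0 mulr1 addr0.
  by rewrite ltr_wpDl ?mulr_ge0 ?(ltW c0) ?subr_ge0// lt_neqAle eq_sym a0'.
have num : 0 < expR (x * t) * (1 - a) + a * expR t.
  have [->|a0'] := eqVneq a 0; first by rewrite subr0 mulr1 mul0r addr0.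
  rewrite ltr_wpDl ?mulr_ge0 ?(ltW c0) ?subr_ge0// mulr_gt0//.
  by rewrite lt_neqAle eq_sym a0'.
pose f u : R := u^-1 * ln ((expR (x * u) * (1 - a) + a * expR u) /
  (expR (x * u) * (1 - a) + a)).
have Ef : {near t, f =1 limit_path x a}.
  have : \forall u \near t, u != 0 by exact: cvgr_neq0 cvg_id t0.
  by apply: filterS => u u0; rewrite /f /limit_path (negbTE u0).
have e1 : expR (x * u) @[u --> t] --> expR (x * t).
  apply: continuous_cvg; first exact: continuous_expR.
  by apply: cvgM; [exact: cvg_cst | exact: cvg_id].
have e2 : expR u @[u --> t] --> expR t by exact: continuous_expR.
have e3 : (expR (x * u) * (1 - a)) @[u --> t] --> expR (x * t) * (1 - a).
  by apply: cvgM => //; exact: cvg_cst.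
rewrite /prop_for /continuous_at.
have -> : limit_path x a t = f t by rewrite /f /limit_path (negbTE t0).
apply: cvg_trans (near_eq_cvg Ef) _.
apply: cvgM; first by apply: cvgV => //; exact: cvg_id.
apply: continuous_cvg; first by apply: continuous_ln; rewrite divr_gt0.
apply: cvgM.
  by apply: cvgD => //; apply: cvgM => //; exact: cvg_cst.
apply: cvgV; first by rewrite gt_eqF.
by apply: cvgD => //; exact: cvg_cst.
Qed.

Lemma pr_le_sum (R : realType) (d : measure_display) (Omega : measurableType d)
    (P : probability Omega R) (I : finType) (B : I -> set Omega) (E : set Omega) :
  measurable E -> (forall i, measurable (B i)) ->
  (forall w, E w -> exists i, B i w) -> pr P E <= \sum_i pr P (B i).
Proof.
move=> mE mB EB.
have mU (s : seq I) : measurable (\big[setU/set0]_(i <- s) B i).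
  by elim/big_ind : _ => // *; exact: measurableU.
apply: (@le_trans _ _ (pr P (\big[setU/set0]_(i <- index_enum I) B i))).
  apply: le_pr => // w /EB [i Bi].
  by rewrite -bigcup_seq; exists i; [exact: mem_index_enum | exact: Bi].
elim: (index_enum I) => [|i s IH]; first by rewrite !big_nil /pr measure0.
rewrite !big_cons; set U := \big[setU/set0]_(j <- s) B j in IH *.
have -> : B i `|` U = B i `|` (U `\` B i) by rewrite setDE setUIr setUCr setIT.
have mD : measurable (U `\` B i) by exact: measurableD (mU s) (mB i).
have mU' : measurable U by exact: mU.
rewrite prU//; last by apply/seteqP; split => // w [h [_ nh]].
rewrite lerD2l; apply: le_trans IH.
by apply: le_pr => // w [].
Qed.

Section Event.
Context (R : realType) (d : measure_display) (Omega : measurableType d).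
Variables (P : probability Omega R) (n : nat).
Variables (l : 'I_n -> R -> Omega -> nat) (sigma : R -> Omega -> 'S_n).
Hypothesis Hsigma : birth_mallows_process P l sigma.
Variables (T alpha eps : R).
Hypotheses (T0 : 0 < T).

Let q (t : R) := expR (t / n%:R).

Definition path_error (i : 'I_n) (t : R) (w : Omega) : R :=
  `|rescaled_path sigma i t w - limit_path (i.+1%:R / n%:R) (rescaled_path sigma i 0 w) t|.

Lemma measurable_path_error i t (D : R -> Prop) :
  measurable [set w | D (path_error i t w)].
Proof.
rewrite /path_error; under eq_set do rewrite !(rescaled_pathE Hsigma).
apply: (@measurable_nat_family _ _ ('I_n * bool)%type
  (fun jb => l jb.1 (if jb.2 then q t else q 0))
  (fun v => let ab (b : bool) := chain (ord_fun (fun j => v (j, b))) i.+1 (v (i, b))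
    (n - i.+1) in D `|n%:R^-1 * (n - ab true)%:R - limit_path (i.+1%:R / n%:R)
      (n%:R^-1 * (n - ab false)%:R) t|)).
case=> j b k; apply: (measurable_birth_level (mallows_birth Hsigma j)).
by case: b; exact: expR_ge0.
Qed.

Lemma rescaled_path_ge0_le1 i t w : 0 <= rescaled_path sigma i t w <= 1.
Proof.
have n0 : 0 < n%:R :> R by rewrite ltr0n; apply: leq_ltn_trans (ltn_ord i).
rewrite /rescaled_path mulr_ge0 ?invr_ge0 ?(ltW n0)//=.
by rewrite ler_pdivrMl// mulr1 ler_nat.
Qed.

Lemma path_error_right (i : 'I_n) t w : t != 0 -> t < T -> eps < path_error i t w ->
  exists2 eta, 0 < eta & forall u, t < u -> u < t + eta -> u <= T ->
    eps < path_error i u w.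
Proof.
move=> t0 tT et.
have n0 : (0 < n)%N by apply: leq_ltn_trans (ltn_ord i).
have nR : 1 <= n%:R :> R by rewrite ler1n.
have n00 : 0 < n%:R :> R by rewrite ltr0n.
have [e1 e10 H1] := path_right_constant Hsigma w (expR_ge0 (t / n%:R)).
pose x : R := i.+1%:R / n%:R; pose a := rescaled_path sigma i 0 w.
have a01 : 0 <= a <= 1 by exact: rescaled_path_ge0_le1.
have := @limit_path_continuous _ x _ _ a01 t0.
move=> /cvgr_dist_lt /(_ (path_error i t w - eps)).
rewrite subr_gt0 => /(_ et) [e2 /= e20 H2].
(* Dividing by [expR T] converts the window [e1] for the process time [q t] into one for [t]. *)
exists (Num.min e2 (e1 / expR T)); first by rewrite lt_min e20 divr_gt0// expR_gt0.
move=> u tu; rewrite -ltrBlDl lt_min => /andP[u1 u2] uT.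
have xu : rescaled_path sigma i u w = rescaled_path sigma i t w.
  rewrite /rescaled_path (H1 (q u))//.
    by rewrite ler_expR ler_wpM2r ?invr_ge0 ?ltW.
  rewrite -ltrBlDl.
  have un z : z <= T -> z / n%:R <= T.
    move=> zT; have [z0|z0] := leP 0 z.
      by apply: le_trans zT; rewrite ler_piMr// invf_le1.
    by apply: le_trans (ltW T0); rewrite mulr_le0_ge0 ?invr_ge0 ?ltW.
  apply: le_lt_trans (ler_norm _) _.
  apply: le_lt_trans (expR_dist_le (un _ uT) (un _ (ltW tT))) _.
  rewrite -mulrBl normrM [X in _ * (_ * X)]gtr0_norm ?invr_gt0// gtr0_norm ?subr_gt0//.
  apply: (@le_lt_trans _ _ (expR T * (u - t))).
    by rewrite ler_wpM2l ?expR_ge0// ler_piMr ?subr_ge0 ?(ltW tu)// invf_le1.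
  by rewrite mulrC -ltr_pdivlMr ?expR_gt0.
have := H2 u; rewrite /ball_/= distrC ger0_norm ?subr_ge0 ?(ltW tu)// => /(_ u1).
rewrite /path_error xu -/x -/a distrC => Hz.
have := ler_distD (limit_path x a u) (rescaled_path sigma i t w) (limit_path x a t).
move: Hz; lra.
Qed.

Lemma measurable_error_event : measurable [set w | exists2 i : 'I_n,
  (alpha * n%:R < i.+1%:R) && (i.+1%:R < (1 - alpha) * n%:R) &
  exists2 t, `[- T, T]%classic t & eps < path_error i t w].
Proof.
pose time (v : option rat) : R := if v is Some r then ratr r else T.
pose F (iv : 'I_n * option rat) := [set w |
  [/\ (alpha * n%:R < iv.1.+1%:R) && (iv.1.+1%:R < (1 - alpha) * n%:R),
   - T <= time iv.2 <= T & eps < path_error iv.1 (time iv.2) w]].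
have -> : [set w | exists2 i : 'I_n,
  (alpha * n%:R < i.+1%:R) && (i.+1%:R < (1 - alpha) * n%:R) &
  exists2 t, `[- T, T]%classic t & eps < path_error i t w] = \bigcup_iv F iv.
  apply/seteqP; split => w /=; last first.
    by move=> [[i v] _ /= [ci tT et]]; exists i => //; exists (time v).
  move=> [i ci [t tT et]]; rewrite /= in_itv /= in tT; move: (tT) => /andP[t1 t2].
  have Ft v : time v = t -> (\bigcup_iv F iv) w.
    by move=> tv; exists (i, v) => //; split => //=; rewrite tv.
  have [tTe|tT'] := eqVneq t T; first exact: (Ft None).
  have [t0|t0] := eqVneq t 0; first by apply: (Ft (Some 0)); rewrite /= rmorph0 t0.
  have ltT : t < T by rewrite lt_neqAle tT'.
  have [eta eta0 H] := path_error_right t0 ltT et.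
  have tm : t < Num.min T (t + eta) by rewrite lt_min ltT ltrDl.
  have [r] := rat_in_itvoo tm; rewrite in_itv /= lt_min => /andP[tr /andP[rT re]].
  exists (i, Some r) => //; split => //=.
    by apply/andP; split; [exact: le_trans t1 (ltW tr) | exact: ltW].
  by apply: H => //; exact: ltW.
apply: countable_bigcupT_measurable => [|[i v]]; first exact: countableP.
have [h|h] := EM ((alpha * n%:R < i.+1%:R) && (i.+1%:R < (1 - alpha) * n%:R) /\
  - T <= time v <= T).
  rewrite (_ : F _ = [set w | eps < path_error i (time v) w]).
    exact: (measurable_path_error i (time v) (fun x => eps < x)).
  by apply/seteqP; split => w /=; [case | move=> H; case: h => *; split].
rewrite (_ : F _ = set0)//; apply/seteqP; split => w //= [h1 h2 _].
by apply: h.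
Qed.

End Event.

(** * Union bound and convergence *)

Lemma sqr_expR_le (R : realType) (c : R) (n : nat) : 0 < c -> (0 < n)%N ->
  n%:R ^+ 2 * expR (- c * n%:R) <= 27 / c ^+ 3 * n%:R^-1.
Proof.
move=> c0 n0; have nR : 0 < n%:R :> R by rewrite ltr0n.
have x0 : 0 < c * n%:R / 3 by rewrite !mulr_gt0.
(* The cube of [y <= expR y] at [y = c * n / 3]: the third power beats [n ^+ 2] by one factor [n],
   and [27 = 3 ^+ 3]. *)
have : (c * n%:R / 3) ^+ 3 <= expR (c * n%:R).
  rewrite (_ : c * n%:R = 3 * (c * n%:R / 3)); last by field.
  rewrite [expR _]expRM_natl [in leLHS](_ : 3 * _ = c * n%:R); last by field.
  rewrite lerXn2r ?nnegrE ?expR_ge0 ?(ltW x0)//.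
  by apply: le_trans (expR_ge1Dx _); rewrite lerDr.
move=> H; rewrite mulNr expRN ler_pdivrMr ?expR_gt0//.
apply: (@le_trans _ _ (27 / c ^+ 3 * n%:R^-1 * (c * n%:R / 3) ^+ 3)).
  by rewrite le_eqVlt; apply/orP; left; apply/eqP; field; rewrite !gt_eqF.
by rewrite ler_wpM2l// mulr_ge0 ?divr_ge0 ?exprn_ge0 ?invr_ge0// ltW.
Qed.

Lemma deviation_boundE (R : realType) (T alpha delta : R) :
  0 < T -> 0 < alpha -> 0 < delta -> exists A c : R, [/\ 0 < A, 0 < c &
    forall n, deviation_bound n T alpha delta = A * expR (- c * n%:R)].
Proof.
move=> T0 alpha0 delta0.
have L1 : 1 <= expR (2 * T) by rewrite -[leLHS]expR0 ler_expR mulr_ge0// ltW.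
have aa : alpha * 1 <= alpha by rewrite mulr1.
have [l0 _ _ _] := deviation_exponent alpha0 delta0 L1 alpha0 aa ltr01.
rewrite /deviation_bound; eexists; eexists; split; last by move=> n; reflexivity.
  exact: expR_gt0.
by rewrite divr_gt0// mulr_gt0.
Qed.

Section ErrorProbability.
Context (R : realType) (d : measure_display) (Omega : measurableType d).
Variables (P : probability Omega R) (n : nat).
Variables (l : 'I_n -> R -> Omega -> nat) (sigma : R -> Omega -> 'S_n).
Hypothesis Hsigma : birth_mallows_process P l sigma.
Variables (T alpha delta eps : R) (N : nat).
Hypotheses (n0 : (0 < n)%N) (T0 : 0 < T) (alpha0 : 0 < alpha) (delta0 : 0 < delta).
Hypothesis N0 : (0 < N)%N.
Hypothesis small : transfer_constant T alpha * (delta + 2 * T / N%:R + n%:R^-1) <= eps.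

Definition error_event : set Omega := [set w | exists2 i : 'I_n,
  (alpha * n%:R < i.+1%:R) && (i.+1%:R < (1 - alpha) * n%:R) &
  exists2 t, `[- T, T]%classic t & eps < path_error sigma i t w].

Let h : R := 2 * T / N%:R.
Let NR : 0 < N%:R :> R. Proof. by rewrite ltr0n. Qed.
Let h0 : 0 < h. Proof. by rewrite divr_gt0// mulr_gt0. Qed.

(* The points with [g <= N.+1] form a grid of [[- T, T]] of mesh [h]; the extra
   index [N.+2] adds the time [0], at which the limit path is anchored. *)
Definition grid_time (g : nat) : R :=
  if g == N.+2 then 0 else Num.min T (- T + g%:R * h).

Lemma grid_time_range g : - T <= grid_time g <= T.
Proof.
have T0' := ltW T0; rewrite /grid_time; case: ifP => _.
  by rewrite oppr_le0 T0'.
rewrite ge_min lexx andbT le_min; apply/andP; split; first by lra.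
by rewrite lerDl mulr_ge0// ltW.
Qed.

Lemma grid_time_around t : - T <= t <= T -> exists2 g, (g <= N)%N &
  [/\ grid_time g <= t, t <= grid_time g.+1, t - grid_time g <= h &
      grid_time g.+1 - t <= h].
Proof.
move=> /andP[t1 t2]; have x0 : 0 <= (t + T) / h by rewrite divr_ge0 ?(ltW h0)//; lra.
(* For [t = T] this gives [g = N], so the right neighbour is the grid index [N.+1], which the
   minimum in [grid_time] caps at [T]. *)
have /andP[] := truncn_itv x0; set g := Num.trunc _ => g1 g2.
have gN : (g <= N)%N.
  rewrite -(ler_nat R); apply: le_trans g1 _; rewrite ler_pdivrMr//.
  by rewrite /h mulrC divfK ?gt_eqF//; lra.
exists g => //; rewrite /grid_time !ltn_eqF ?ltnS ?leqW//.
move: g1 g2; rewrite ler_pdivlMr// ltr_pdivrMr// => g1 g2.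
have g3 : g.+1%:R * h = g%:R * h + h by rewrite -natr1; ring.
have h0' := ltW h0.
split.
- by rewrite ge_min; apply/orP; right; lra.
- by rewrite le_min t2; lra.
- rewrite lerBlDr addrC -lerBlDr le_min; apply/andP; split; lra.
- by rewrite lerBlDr ge_min; apply/orP; right; lra.
Qed.

(** One finite index type for the whole union bound: [bad_time] is repeated for every start [r], and
    inadmissible indices give the empty event. The boolean and the two-sided deviations account for
    the factor 4 in [pr_error_event]. *)
Let bad (k : 'I_n * 'I_n * 'I_N.+3 * bool) : set Omega :=
  let: (i, r, g, b) := k in
  if (alpha * n%:R <= i.+1%:R) && (r < i.+1)%N then
    if b then bad_chain l delta (grid_time g) i r else bad_time l delta (grid_time g) i
  else set0.

Lemma pr_error_event :
  pr P error_event <= 4 * N.+3%:R * (n%:R ^+ 2 * deviation_bound n T alpha delta).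
Proof.
have mbad k : measurable (bad k).
  case: k => [[[i r] g] b]; rewrite /bad; case: ifP => // _; case: b.
    exact: (measurable_bad_chain Hsigma).
  exact: (measurable_bad_time Hsigma).
have mE : measurable error_event by exact: (measurable_error_event Hsigma).
apply: (le_trans (pr_le_sum P mE mbad _)); last first.
  apply: (@le_trans _ _ (\sum_(k : 'I_n * 'I_n * 'I_N.+3 * bool)
      2 * deviation_bound n T alpha delta)).
    apply: ler_sum => -[[[i r] g] b] _; rewrite /bad; case: ifP => [/andP[ai ri]|_].
      by case: b; [apply: (pr_bad_chain Hsigma) | apply: (pr_bad_time Hsigma)] => //;
        exact: grid_time_range.
    by rewrite /pr measure0 mulr_ge0// mulr_ge0 ?expR_ge0.
  rewrite sumr_const !card_prod !card_ord card_bool -[leLHS]mulr_natl !natrM.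
  by rewrite le_eqVlt; apply/orP; left; apply/eqP; ring.
move=> w [i /andP[ai _] [t]]; rewrite /= in_itv /= => tT et; apply: contrapT => nbad.
have [g gN [g1 g2 g3 g4]] := grid_time_around tT.
have iw := ltW ai.
have nb (g' : nat) r b : (g' < N.+3)%N -> (r < i.+1)%N ->
    ~ (if b then bad_chain l delta (grid_time g') i r else
       bad_time l delta (grid_time g') i) w.
  move=> gN' ri H; apply: nbad.
  have rn : (r < n)%N by apply: leq_trans ri _; exact: ltn_ord.
  by exists (i, Ordinal rn, Ordinal gN', b); rewrite /bad /= iw ri.
have gN1 : (g < N.+3)%N by do 2 apply: leqW.
have gN2 : (g.+1 < N.+3)%N by rewrite ltnS leqW.
have t0E : grid_time N.+2 = 0 by rewrite /grid_time eqxx.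
have /andP[r1 _] := grid_time_range g; have /andP[_ r2] := grid_time_range g.+1.
move: et; rewrite ltNge => /negP; apply; apply: le_trans small.
apply: (sandwich Hsigma n0 T0 alpha0 r1 g1 g2 r2 g3 g4 iw).
  by move=> s [->|->]; [exact: (nb g 0%N false) | exact: (nb g.+1 0%N false)].
move=> s r [->|->|->] ri; [exact: (nb g r true)| exact: (nb g.+1 r true)|].
by rewrite -t0E; exact: (nb N.+2 r true).
Qed.

End ErrorProbability.

Theorem theorem1p1 (R : realType)
    (d : nat -> measure_display)
    (Omega : forall n : nat, measurableType (d n))
    (P : forall n : nat, probability (Omega n) R)
    (l : forall n : nat, 'I_n -> R -> Omega n -> nat)
    (sigma : forall n : nat, R -> Omega n -> 'S_n)
    (Hsigma : forall n : nat, birth_mallows_process (P n) (l n) (sigma n))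
    (T alpha eps : R) (HT : 0 < T) (Halpha : 0 < alpha) (Heps : 0 < eps) :
  P n [set w : Omega n |
    (eps%:E < \big[maxe/0%E]_(i < n | ((alpha * n%:R < i.+1%:R) &&
                                       (i.+1%:R < (1 - alpha) * n%:R))%R)
       ereal_sup [set (`|rescaled_path (sigma n) i t w
                        - limit_path (i.+1%:R / n%:R)
                            (rescaled_path (sigma n) i 0 w) t|%R)%:E
                 | t in `[(- T)%R, T]])%E]
  @[n --> \oo] --> 0%E.
Proof.
pose C := transfer_constant T alpha.
have C0 : 0 < C.
  have a0 : 0 < 1 + alpha^-1 by rewrite addr_gt0 ?invr_gt0.
  have L0 k : 0 < expR (2 * T) ^+ k by rewrite exprn_gt0 ?expR_gt0.
  apply: addr_gt0 => //; apply: mulr_gt0; first exact: L0.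
  by apply: mulr_gt0 => //; apply: mulr_gt0 => //; exact: L0.
(* The deviation, the mesh of the grid and [1 / n] each receive a third of [eps / C]; in particular
   [N] below is chosen independently of [n]. *)
pose delta := eps / (3 * C); have delta0 : 0 < delta by rewrite divr_gt0// mulr_gt0.
have Cd : C * (delta + delta + delta) = eps by rewrite /delta; field; rewrite gt_eqF.
have [N N0 TN] : exists2 N, (0 < N)%N & 2 * T / N%:R <= delta.
  exists (Num.truncn (2 * T / delta)).+1 => //.
  rewrite ler_pdivrMr// [leRHS]mulrC -ler_pdivrMr//.
  have Td : 0 <= 2 * T / delta.
    by apply: divr_ge0; [apply: mulr_ge0 => // | ]; exact: ltW.
  by have /andP[_ /ltW] := truncn_itv Td.
pose E n := error_event (sigma n) T alpha eps.
rewrite [X in X @ _](_ : _ = fun n => (pr (P n) (E n))%:E); last first.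
  apply/funext => n; rewrite -prK; last exact: (measurable_error_event (Hsigma n)).
  congr (P n _); apply/seteqP; split => w /=.
    by move/(lt_bigmax_ereal_sup _ _ _ Heps).
  by move=> H; apply/(lt_bigmax_ereal_sup _ _ _ Heps).
have [A [c [A0 c0 dE]]] := deviation_boundE HT Halpha delta0.
pose M := 4 * N.+3%:R * (A * (27 / c ^+ 3)).
have M0 : 0 < M.
  apply: mulr_gt0; first exact: mulr_gt0.
  by apply: mulr_gt0 => //; apply: divr_gt0 => //; exact: exprn_gt0.
apply: cvg_EFin; first by apply: nearW.
apply/cvgrPdist_le => e e0; near=> n.
have nd : delta^-1 <= n%:R by near: n; exact: nbhs_infty_ger.
have ne : M / e <= n%:R by near: n; exact: nbhs_infty_ger.
have nR : 0 < n%:R :> R by apply: lt_le_trans nd; rewrite invr_gt0.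
have n0 : (0 < n)%N by rewrite -(ltr0n R).
have small : C * (delta + 2 * T / N%:R + n%:R^-1) <= eps.
  have nV : n%:R^-1 <= delta by rewrite -[leRHS]invrK lef_pV2 ?posrE ?invr_gt0.
  by rewrite -Cd ler_wpM2l ?(ltW C0)// !lerD.
rewrite sub0r normrN ger0_norm ?pr_ge0//.
apply: le_trans (pr_error_event (Hsigma n) n0 HT Halpha delta0 N0 small) _.
rewrite dE [leLHS](_ : _ = 4 * N.+3%:R * A * (n%:R ^+ 2 * expR (- c * n%:R)));
  last by ring.
apply: (@le_trans _ _ (M * n%:R^-1)).
  rewrite (_ : M * _ = 4 * N.+3%:R * A * (27 / c ^+ 3 * n%:R^-1)); last by rewrite /M; ring.
  by rewrite ler_wpM2l ?sqr_expR_le// !mulr_ge0// ltW.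
by rewrite ler_pdivrMr// mulrC -ler_pdivrMr.
Unshelve. all: by end_near.
Qed.
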